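(* Let $\mu^{(2)}$ be the permuton characterized by $$\int_{[0,1]^2}h(x,y)\,\mu^{(2)}(dx,dy)=\int_0^{1/2}h(t,\tfrac12+t)\,dt+\int_{[0,1]^2}\tfrac12\,h\!\left(\tfrac{x+1}2,\tfrac y2\right)\mu^{(1)}(dx,dy)$$ for every bounded measurable $h:[0,1]^2\to\mathbb R$, where $\mu^{(1)}$ is the permuton with density $$f(x,y)=\begin{cases}1+\sin(\log x)&\text{if }(x,y)\in(0,1/2)\times(0,1/2),\\ 1-\sin(\log x)&\text{if }(x,y)\in(0,1/2)\times(1/2,1),\\ 1-C&\text{if }(x,y)\in(1/2,1)\times(0,1/2),\\ 1+C&\text{if }(x,y)\in(1/2,1)\times(1/2,1),\end{cases}\qquad C:=2\int_0^{1/2}\sin(\log x)\,dx .$$ Let $\mathcal P^n_{\mu^{(2)}}$ be a set of $n$ i.i.d. random points with distribution $\mu^{(2)}$. Then the sequence of random trees $\mathcal T\langle\mathcal P^n_{\mu^{(2)}}\rangle$ does not converge in distribution for the subtree size topology as $n\to\infty$.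
   Context: A permuton is a probability measure on $[0,1]^2$ with uniform marginals on both axes. Binary search trees: nodes of binary trees are identified with finite words in $\mathbb V=\{0,1\}^*$ (the empty word $\varnothing$ is the root; $w0$, $w1$ are the left and right children of $w$). For a finite sequence $y=(y_1,\dots,y_n)$ of distinct reals, $\mathcal T\langle y\rangle$ is the labeled binary tree obtained by inserting $y_1,\dots,y_n$ successively into the empty tree: to insert a value, start at the root, move to the left child if the value is smaller than the label of the current node and to the right child if it is larger, until an empty position is reached, where a new node with this label is created. For a finite point set $\mathcal P\subset\mathbb R^2$ with distinct $x$- and distinct $y$-coordinates, $\mathcal T\langle\mathcal P\rangle:=\mathcal T\langle y_{(1)},\dots,y_{(n)}\rangle$, where the points $(x_{(i)},y_{(i)})$ of $\mathcal P$ are ordered so that $x_{(1)}<\dots<x_{(n)}$. Subtree size convergence: for a finite tree $\mathcal T$ with $|\mathcal T|$ nodes and $v\in\mathbb V$, let $t(\mathcal T,v)=\frac1{|\mathcal T|}|\{u\in\mathcal T:v\text{ is a prefix of }u\}|$. Random trees $\mathcal T^n$ converge in distribution for the subtree size topology if $(t(\mathcal T^n,v))_{v\in\mathbb V}$ converges in distribution in $[0,1]^{\mathbb V}$ with the product topology, to a random function $\psi$ satisfying $\psi(\varnothing)=1$ and $\psi(v)=\psi(v0)+\psi(v1)$ for all $v$. *)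

(* Defs.v *)
From HB Require Import structures.
From mathcomp Require Import all_boot all_order all_algebra.
From mathcomp Require Import all_classical all_reals all_analysis.

Set Implicit Arguments.
Unset Strict Implicit.
Unset Printing Implicit Defensive.

Import Order.TTheory GRing.Theory Num.Theory.
Import numFieldNormedType.Exports.

Local Open Scope classical_set_scope.
Local Open Scope ring_scope.

Definition unit_square (R : realType) : set (R * R) := `[0, 1] `*` `[0, 1].

(* Measures on [0,1]^2 are represented as measures on R^2 carried by
   [0,1]^2. *)
Definition permuton (R : realType) (mu : probability (R * R)%type R) : Prop :=
  [/\ mu (@unit_square R) = 1%E,
      forall A : set R, measurable A ->
        mu (fst @^-1` A) = uniform_prob (@ltr01 R) A &
      forall A : set R, measurable A ->
        mu (snd @^-1` A) = uniform_prob (@ltr01 R) A].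

Definition has_density (R : realType) (mu : probability (R * R)%type R)
    (f : R * R -> R) : Prop :=
  forall A : set (R * R), measurable A ->
    mu A = (\int[lebesgue_measure \x lebesgue_measure]_(z in A) (f z)%:E)%E.

Definition dens_const (R : realType) : R :=
  2 * \int[lebesgue_measure]_(x in `[0, 2^-1]) sin (ln x).

(* The value on the null boundary lines is set to 0; outside [0,1]^2 it must
   be 0 for the density to be taken over R^2. *)
Definition density1 (R : realType) (z : R * R) : R :=
  let: (x, y) := z in
  if (0 < x < 2^-1) && (0 < y < 2^-1) then 1 + sin (ln x)
  else if (0 < x < 2^-1) && (2^-1 < y < 1) then 1 - sin (ln x)
  else if (2^-1 < x < 1) && (0 < y < 2^-1) then 1 - dens_const R
  else if (2^-1 < x < 1) && (2^-1 < y < 1) then 1 + dens_const R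
  else 0.

(* For z in [0,1]^2 both arguments of h on the right-hand side lie in
   [0,1]^2, so only the values of h on the square are used. *)
Definition char2 (R : realType) (mu1 mu2 : probability (R * R)%type R) : Prop :=
  forall h : R * R -> R,
    measurable_fun (@unit_square R) h ->
    (exists M : R, forall z, unit_square z -> `|h z| <= M) ->
    (\int[mu2]_(z in @unit_square R) (h z)%:E =
     \int[lebesgue_measure]_(t in `[0%R, 2^-1%R]) (h (t, 2^-1 + t)%R)%:E +
     \int[mu1]_(z in @unit_square R)
        (2^-1 * h ((z.1 + 1) / 2, z.2 / 2))%R%:E)%E.

Inductive btree (T : Type) : Type :=
| Empty : btree T
| Node : btree T -> T -> btree T -> btree T.
Arguments Empty {T}.
Arguments Node {T} _ _ _.

(* A value equal to the current label goes to the right; this only matters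
   for sequences with repeated values. *)
Fixpoint bst_insert (R : realType) (t : btree R) (y : R) : btree R :=
  match t with
  | Empty => Node Empty y Empty
  | Node l x r =>
      if y < x then Node (bst_insert l y) x r else Node l x (bst_insert r y)
  end.

Definition bst (R : realType) (ys : seq R) : btree R :=
  foldl (@bst_insert R) Empty ys.

(* Points are given by a list. When their x-coordinates are distinct, the
   sorted list, hence the tree, depends only on the underlying set. *)
Definition bst_points (R : realType) (ps : seq (R * R)) : btree R :=
  bst [seq p.2 | p <- sort (fun p q : R * R => p.1 <= q.1) ps].

(* Positions are words over bool: false is the letter 0 (left), true is the
   letter 1 (right), and words are read from the root. *)
Fixpoint nodes (T : Type) (t : btree T) : seq (seq bool) :=
  match t with
  | Empty => [::]
  | Node l _ r =>
      [::] :: [seq false :: u | u <- nodes l] ++ [seq true :: u | u <- nodes r]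
  end.

(* On the empty tree this is 0, by the convention 0^-1 = 0. *)
Definition subtree_frac (R : realType) (T : Type) (t : btree T) :
    {ptws seq bool -> R} :=
  fun v => (count (prefix v) (nodes t))%:R / (size (nodes t))%:R.

Definition unit_cube (R : realType) : set {ptws seq bool -> R} :=
  [set x | forall v, 0 <= x v <= 1].

(* Weak convergence in [0,1]^V is tested on the functions g that are
   continuous on the cube [0,1]^V for the product topology; such g are
   automatically bounded there, by compactness. *)
Definition subtree_size_cvg (R : realType) (d : nat -> measure_display)
    (Omega : forall n, measurableType (d n))
    (P : forall n, probability (Omega n) R)
    (T : forall n, Omega n -> btree R) : Prop :=
  exists (d' : measure_display) (Omega' : measurableType d')
    (P' : probability Omega' R) (psi : seq bool -> {RV P' >-> R}),
  [/\ forall w v, 0 <= psi v w <= 1,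
      {ae P', forall w, psi [::] w = 1 /\
        forall v, psi v w = psi (rcons v false) w + psi (rcons v true) w} &
      forall g : {ptws seq bool -> R} -> R,
        {within @unit_cube R, continuous g} ->
        ('E_(P n)[fun w => g (subtree_frac R (T n w))] @[n --> \oo] -->
         'E_P'[fun w => g (fun v => psi v w)])%E].

Definition iid_points (R : realType) d (Omega : measurableType d)
    (P : probability Omega R) (mu : probability (R * R)%type R) (n : nat)
    (Z : 'I_n -> {RV P >-> (R * R)%type}) : Prop :=
  (forall i (A : set (R * R)), measurable A -> distribution P (Z i) A = mu A) /\
  (forall A : 'I_n -> set (R * R), (forall i, measurable (A i)) ->
     P [set w | forall i, A i (Z i w)] =
     (\prod_(i < n) P [set w | A i (Z i w)])%E).

(* Main.v *)
(* The expected value of the coordinate t(T, 00) already fails to converge.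
   In the [mu2]-sample the points with x <= 1/2 increase and lie above the
   points with x > 1/2, so the left subtree of the root is the search tree of
   the points of the right half. Its root is the leftmost of them, with height
   Y say, and the subtree at 00 collects the points below Y: t(T, 00) is the
   proportion of points of height less than Y.  Up to o(1) its mean counts the
   ordered pairs (i, j) such that the j-th point lies in the right half, is
   above the i-th, and no third point of the right half precedes it. By
   independence each pair has the probability

     int_{x > 1/2} y (3/2 - x)^(n-2) dmu2
       = 1/4 int y (1 - x/2)^(n-2) dmu1,

   which up to exponentially small terms is
   1/4 int_0^2 (1 - x/2)^(n-2) (1/2 - sin (ln x) / 4) dx.  Integration by parts
   shows that z_n = (n+1) int_0^2 (1 - x/2)^n exp(i ln x) dx satisfies
   z_n = z_{n+1} (1 + i/(n+2)): its modulus stays away from 0 while its argument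
   drifts like - ln n, so its imaginary part does not converge. *)
From HB Require Import structures.
Require Import Defs.
From mathcomp Require Import all_boot all_order all_algebra.
From mathcomp Require Import all_classical all_reals all_analysis.
From mathcomp Require Import measurable_realfun.
From mathcomp Require Import ring lra.

Set Implicit Arguments.
Unset Strict Implicit.
Unset Printing Implicit Defensive.

Import Order.TTheory GRing.Theory Num.Theory.
Import numFieldNormedType.Exports.

Local Open Scope classical_set_scope.
Local Open Scope ring_scope.

(** * A planar sequence that rotates forever *)

(** Telescoping bounds the harmonic sums beyond [N] by [(u n - u N) / c], so a bounded [u] would
    make the harmonic series converge. *)
Lemma harmonic_increments_unbounded (R : realType) (u : R^nat) (c M : R)
    (N : nat) :
  0 < c -> (forall n, (N <= n)%N -> c / n.+1%:R <= u n.+1 - u n) ->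
  (forall n, `|u n| <= M) -> False.
Proof.
move=> c0 hu hM; apply: (@dvg_harmonic R).
have step n : (N <= n)%N -> series (@harmonic R) n <=
    series (@harmonic R) N + (u n - u N) / c.
  elim: n => [|n IH].
    by rewrite leqn0 => /eqP ->; rewrite subrr mul0r addr0.
  rewrite leq_eqVlt => /orP[/eqP <-|]; first by rewrite subrr mul0r addr0.
  rewrite ltnS => Nn; have := hu _ Nn; rewrite -ler_pdivlMl// => hn.
  rewrite /series/= big_nat_recr//= -/(series (@harmonic R) n).
  apply: (le_trans (lerD (IH Nn) hn)).
  by rewrite -addrA lerD2l [c^-1 * _]mulrC -mulrDl addrC addrA subrK.
apply: nondecreasing_is_cvgn.
  by apply: nondecreasing_series => i _ _; rewrite invr_ge0.
exists (series (@harmonic R) N + (M + M) / c) => _ [n _ <-].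
have [Nn|/ltnW nN] := leqP N n.
  apply: (le_trans (step _ Nn)); rewrite lerD2l ler_pM2r ?invr_gt0//.
  have := hM n; have := hM N; rewrite !ler_norml; lra.
apply: (@le_trans _ _ (series (@harmonic R) N)).
  by apply: nondecreasing_series => // i _ _; rewrite invr_ge0.
rewrite lerDl divr_ge0 ?(ltW c0)// addr_ge0//; exact: le_trans (hM 0%N).
Qed.

(* With [z n = k n + i s n] the hypotheses say [z n = z n.+1 * (1 + i / (n + 2))];
   hence [|z n|] stays away from 0 while the argument of [z n] drifts like
   [- ln n]. *)
Lemma rotating_sequence_not_cvg (R : realType) (s k : R^nat) :
  (forall n, s n = s n.+1 + k n.+1 / n.+2%:R) ->
  (forall n, k n = k n.+1 - s n.+1 / n.+2%:R) ->
  0 < s 0%N ^+ 2 + k 0%N ^+ 2 -> ~ cvgn s.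
Proof.
move=> hs hk q0.
(* The squared modulus of [z n]. *)
pose q n := s n ^+ 2 + k n ^+ 2.
have qE n : q n = q n.+1 * (1 + (n.+2%:R ^+ 2)^-1).
  rewrite /q (hs n) (hk n); set m := n.+2%:R.
  have m0 : m != 0 by rewrite pnatr_eq0.
  by field.
(* Each step divides [q] by [1 + 1/(n+2)^2], which is at most [(1 + 1/(n+1)) / (1 + 1/(n+2))]. The
   product of these ratios telescopes and stays below 2. *)
have qlow n : q 0%N * (1 + n.+1%:R^-1) <= 2 * q n.
  elim: n => [|n IH]; first by rewrite invr1 mulrC.
  have n0 : 0 <= n%:R :> R by [].
  have e : 1 + (n.+2%:R ^+ 2)^-1 <= (1 + n.+1%:R^-1) / (1 + n.+2%:R^-1) :> R.
    rewrite ler_pdivlMr; last by rewrite ltr_pwDl.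
    rewrite -subr_ge0 (_ : _ - _ = (n.+1%:R * n.+2%:R ^+ 3)^-1); last first.
      rewrite -[n.+2%:R]natr1 -[n.+1%:R]natr1; field.
      by apply/andP; split; apply: lt0r_neq0; lra.
    by rewrite invr_ge0 mulr_ge0// exprn_ge0.
  have d0 : 0 < 1 + n.+2%:R^-1 :> R by rewrite ltr_pwDl.
  have q1 : 0 <= q n.+1 by rewrite addr_ge0 ?sqr_ge0.
  rewrite -(ler_pM2r (_ : 0 < (1 + n.+1%:R^-1) / (1 + n.+2%:R^-1) :> R)); last first.
    by rewrite divr_gt0// ltr_pwDl.
  apply: (@le_trans _ _ (2 * q n)).
    rewrite [X in X <= _](_ : _ = q 0%N * (1 + n.+1%:R^-1))//.
    by rewrite -mulrA [_ * (_ / _)]mulrC divfK ?lt0r_neq0.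
  by rewrite (qE n) mulrA ler_wpM2l// mulr_ge0.
have qlow' n : q 0%N / 2 <= q n.
  rewrite ler_pdivrMr// [_ * 2]mulrC; apply: le_trans (qlow n).
  by rewrite ler_peMr ?(ltW q0)// lerDl.
have qup n : q n <= q 0%N.
  elim: n => // n; apply: le_trans; rewrite (qE n) ler_peMr ?lerDl//.
  by rewrite addr_ge0 ?sqr_ge0.
have bound (a b : R) n : q n = a ^+ 2 + b ^+ 2 -> `|a| <= q 0%N + 1.
  move=> e; have := qup n; rewrite e => h.
  have := sqr_ge0 b; have := sqr_ge0 (a - 1); have := sqr_ge0 (a + 1).
  by rewrite ler_norml !expr2 in h *; move=> *; apply/andP; split; nra.
have sB n : `|s n| <= q 0%N + 1 by exact: (bound _ (k n) n).
have kB n : `|k n| <= q 0%N + 1.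
  by apply: (bound _ (s n) n); rewrite addrC.
have dk n : k n.+1 - k n = s n.+1 / n.+2%:R by rewrite (hk n); ring.
have ds n : s n.+1 - s n = - k n.+1 / n.+2%:R by rewrite (hs n); ring.
have shift (u : R^nat) (c M : R) (N : nat) : 0 < c ->
    (forall n, (N <= n)%N -> c / n.+2%:R <= u n.+1 - u n) ->
    (forall n, `|u n| <= M) -> False.
  move=> c0 h hM; apply: (@harmonic_increments_unbounded R (fun n => u n.-1) c M N.+1 c0).
    by case=> // n; rewrite ltnS => /h.
  by move=> n; exact: hM.
move=> /cvg_ex[/= l sl].
have near_l (e : R) : 0 < e -> exists N, forall n, (N <= n)%N -> `|s n - l| < e.
  move=> e0; have /cvgrPdist_lt/(_ _ e0)[N _ h] := sl.
  by exists N => n /h; rewrite distrC.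
(* If [l] is nonzero, the increments [s n.+1 / n.+2] of [k] eventually have the sign of [l] and size
   at least [|l| / 2 / n.+2], so [k] is unbounded. If [l = 0], then [k] stays away from 0 with
   constant sign, and [s] is the unbounded one. *)
have [l0|l0|l0] := ltgtP l 0.
- have [N hN] := near_l (- l / 2) (ltac:(lra)).
  apply: (shift (fun n => - k n) (- l / 2) (q 0%N + 1) N) => //; first lra.
    move=> n Nn; have := hN n.+1 (leqW Nn); rewrite ltr_norml => h.
    have -> : - k n.+1 - - k n = (- s n.+1) / n.+2%:R by rewrite mulNr -dk; ring.
    by rewrite ler_pM2r ?invr_gt0//; lra.
  by move=> n; rewrite normrN.
- have [N hN] := near_l (l / 2) (ltac:(lra)).
  apply: (shift k (l / 2) (q 0%N + 1) N) => //; first lra.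
  move=> n Nn; rewrite dk ler_pM2r ?invr_gt0//.
  by have := hN n.+1 (leqW Nn); rewrite ltr_norml; lra.
- subst l.
  set q0' := q 0%N in q0 qlow qlow' qup sB kB bound.
  (* from some rank on [|k n| >= c] while consecutive terms differ by less
     than [c], so [k] has constant sign *)
  pose c := Num.min 1 (q0' / 8).
  have c0 : 0 < c by rewrite lt_min ltr01/= divr_gt0.
  have c1 : c <= 1 by rewrite ge_min lexx.
  have c8 : c <= q0' / 8 by rewrite ge_min lexx orbT.
  have [N hN] := near_l c c0.
  have kc n : (N <= n)%N -> c < `|k n|.
    move=> /hN; rewrite subr0 => snc.
    rewrite ltNge; apply/negP => knc.
    (* Since [c <= 1] and [c <= q0' / 8], the right side is at most [q0' / 4], below the lower bound
       [q0' / 2] for [q n]. *)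
    have : q n <= c * c + c * c.
      rewrite /q -[s n ^+ 2]real_normK ?num_real// -[k n ^+ 2]real_normK ?num_real//.
      by rewrite !expr2 lerD// ler_pM// ltW.
    have := qlow' n; nra.
  have dkc n : (N <= n)%N -> `|k n.+1 - k n| < c.
    move=> Nn; rewrite dk normrM normfV normr_nat.
    have := hN n.+1 (leqW Nn); rewrite subr0; apply: le_lt_trans.
    by rewrite ler_piMr// invf_le1 ?ler1n.
  have [kN|kN] := lerP 0 (k N).
    have kpos n : (N <= n)%N -> c < k n.
      elim: n => [|n IH].
        by rewrite leqn0 => /eqP NE; have := kc 0%N (eq_leq NE); rewrite -NE ger0_norm.
      rewrite leq_eqVlt => /orP[/eqP NE|].
        by have := kc N (leqnn N); rewrite -NE ger0_norm.
      rewrite ltnS => Nn; have := IH Nn; have := dkc n Nn; rewrite ltr_norml.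
      by have := kc n.+1 (leqW Nn); rewrite lter_normr => /orP[]; lra.
    apply: (shift (fun n => - s n) c (q0' + 1) N) => //.
      move=> n Nn; have -> : - s n.+1 - - s n = k n.+1 / n.+2%:R.
        by rewrite -opprD ds mulNr opprK.
      by rewrite ler_pM2r ?invr_gt0// ltW// kpos// leqW.
    by move=> n; rewrite normrN.
  have kneg n : (N <= n)%N -> k n < - c.
    elim: n => [|n IH].
      rewrite leqn0 => /eqP NE; have := kc 0%N (eq_leq NE).
      by rewrite -NE ltr0_norm//; lra.
    rewrite leq_eqVlt => /orP[/eqP NE|].
      by have := kc N (leqnn N); rewrite -NE ltr0_norm//; lra.
    rewrite ltnS => Nn; have := IH Nn; have := dkc n Nn; rewrite ltr_norml.
    by have := kc n.+1 (leqW Nn); rewrite lter_normr => /orP[]; lra.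
  apply: (shift s c (q0' + 1) N) => //.
  move=> n Nn; rewrite ds ler_pM2r ?invr_gt0//.
  by have := kneg n.+1 (leqW Nn); lra.
Qed.

(** * Binary search trees *)

(** The root routes each later key by one comparison, so the two subtrees grow independently. The
    induction runs over arbitrary initial subtrees. *)
Lemma bst_cons (R : realType) (y : R) (ys : seq R) :
  bst (y :: ys) =
  Node (bst [seq z <- ys | z < y]) y (bst [seq z <- ys | ~~ (z < y)]).
Proof.
rewrite /bst /=; move: (Defs.Empty : btree R) {2 4}(Defs.Empty : btree R) => l r.
elim: ys l r => //= z ys IH l r.
by case: ifP => zy; rewrite IH.
Qed.

Lemma size_nodes_insert (R : realType) (t : btree R) (y : R) :
  size (nodes (bst_insert t y)) = (size (nodes t)).+1.
Proof.
elim: t => //= l IHl x r IHr; case: ifP => _ /=;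
  rewrite !size_cat !size_map ?IHl ?IHr ?addnS ?addSn//.
Qed.

Lemma size_nodes_bst (R : realType) (ys : seq R) :
  size (nodes (bst ys)) = size ys.
Proof.
suff h (t : btree R) :
    size (nodes (foldl (@bst_insert R) t ys)) = (size (nodes t) + size ys)%N.
  by rewrite /bst h.
by elim: ys t => [|y ys IH] t /=; rewrite ?addn0// IH size_nodes_insert addSnnS.
Qed.

Lemma count_prefix_left (T : Type) (l r : btree T) (x : T) (v : seq bool) :
  count (prefix (false :: v)) (nodes (Node l x r)) = count (prefix v) (nodes l).
Proof.
rewrite /= add0n count_cat !count_map [X in (_ + X)%N](_ : _ = 0%N) ?addn0.
  by apply: eq_count => u /=.
by apply/eqP; rewrite -leqn0 leqNgt -has_count; apply/hasPn => u _ /=.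
Qed.

Lemma count_prefix_nil (T : Type) (t : btree T) :
  count (prefix [::]) (nodes t) = size (nodes t).
Proof. by rewrite -[RHS](count_predT); apply: eq_count => -[]. Qed.

Definition right_pt (R : realType) (p : R * R) : bool := 2^-1 < p.1.

(** The shape of the support of [mu2]. Excluding abscissa 0 puts the points of the left half
    strictly above height 1/2, hence above every point of the right half. *)
Definition typical_pt (R : realType) (p : R * R) : bool :=
  [&& 0 <= p.1, p.1 <= 1, 0 <= p.2 &
    if 2^-1 < p.1 then p.2 <= 2^-1 else (0 < p.1) && (p.2 == 2^-1 + p.1)].

(** The first inserted point [h] lies in the left half and is the lowest there, so the keys sent to
    its left are exactly those of the right half, in order of abscissa. The first of them, [f],
    roots the left subtree, and the subtree at 00 holds the keys below [f.2]. *)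
Lemma count_left_left (R : realType) (ps : seq (R * R)) :
  all (@typical_pt R) ps -> has (@right_pt R) ps ->
  has (predC (@right_pt R)) ps ->
  exists f, [/\ f \in ps, right_pt f,
    forall p, p \in ps -> right_pt p -> f.1 <= p.1 &
    count (prefix [:: false; false]) (nodes (bst_points ps)) =
    count (fun p => p.2 < f.2) ps].
Proof.
move=> tp; rewrite /bst_points; set leX := fun p q : R * R => p.1 <= q.1.
have ltot : total leX by move=> p q; exact: le_total.
have ltr : transitive leX by move=> p q r; exact: le_trans.
have prm : perm_eq (sort leX ps) ps by rewrite perm_sort.
rewrite -!(perm_has _ prm) -(perm_all _ prm) in tp *.
have := sort_sorted ltot ps.
have mem p : p \in ps = (p \in sort leX ps) by rewrite (perm_mem prm).
have cnt (a : pred (R * R)) : count a ps = count a (sort leX ps).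
  by rewrite (seq.permP prm).
case: (sort leX ps) tp mem cnt => // h s tp mem cnt srt hr hl.
have hmin p : p \in s -> h.1 <= p.1.
  by have /allP := order_path_min ltr srt; exact.
have hleft : ~~ right_pt h.
  case/hasP: hl => p; rewrite inE => /orP[/eqP -> //|/hmin hp] /=.
  by rewrite /right_pt -!leNgt; exact: le_trans.
have [h0 h2] : 0 < h.1 /\ h.2 = 2^-1 + h.1.
  move: tp => /= /andP[+ _]; rewrite /typical_pt -/(right_pt h) (negbTE hleft).
  by move=> /and4P[_ _ _ /andP[? /eqP]].
have rlow p : p \in s -> right_pt p -> p.2 <= 2^-1.
  move=> ps' rp; move: tp => /= /andP[_ /allP/(_ p ps')].
  by rewrite /typical_pt -/(right_pt p) rp => /and4P[].
have lhigh p : p \in s -> ~~ right_pt p -> h.2 <= p.2.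
  move=> ps' rp; move: tp => /= /andP[_ /allP/(_ p ps')].
  rewrite /typical_pt -/(right_pt p) (negbTE rp) => /and4P[_ _ _ /andP[_ /eqP->]].
  by rewrite h2 lerD2l hmin.
have rE p : p \in s -> (p.2 < h.2) = right_pt p.
  move=> ps'; apply/idP/idP => [|rp].
    by apply: contraTT => /(lhigh _ ps'); rewrite -leNgt.
  by rewrite (le_lt_trans (rlow _ ps' rp))// h2; lra.
rewrite /= in srt; have ssrt := path_sorted srt.
have fsrt : sorted leX [seq p <- s | right_pt p] by exact: sorted_filter.
have fE : [seq z <- [seq p.2 | p <- s] | z < h.2] =
    [seq p.2 | p <- [seq p <- s | right_pt p]].
  by rewrite filter_map; congr map; apply: eq_in_filter => p ps' /=; exact: rE.
have hs : has (@right_pt R) s by move: hr; rewrite /= (negbTE hleft).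
rewrite map_cons bst_cons fE count_prefix_left.
case E : [seq p <- s | right_pt p] fsrt => [|f s'] fsrt.
  by move: hs; rewrite has_filter E.
have fs : f \in s /\ right_pt f.
  have : f \in [seq p <- s | right_pt p] by rewrite E mem_head.
  by rewrite mem_filter => /andP[].
exists f; split.
- by case: fs => fs _; rewrite mem in_cons fs orbT.
- by case: fs.
- move=> p; rewrite mem in_cons => /orP[/eqP -> |ps' rp]; first by rewrite (negbTE hleft).
  have : p \in f :: s' by rewrite -E mem_filter rp.
  rewrite inE => /orP[/eqP -> //|].
  by have /allP := order_path_min ltr fsrt; exact.
rewrite map_cons bst_cons count_prefix_left count_prefix_nil size_nodes_bst.
have fh : f.2 < h.2 by case: fs => fs rf; rewrite rE.
rewrite cnt /= ltNge (ltW fh) add0n size_filter count_map.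
(* Putting [f] back changes nothing, as it is not below itself. Every point below [f.2] is below
   [h.2], hence already in the right half. *)
transitivity (count (fun p => p.2 < f.2) (f :: s')).
  by rewrite /= ltxx add0n.
rewrite -E count_filter; apply: eq_in_count => p ps' /=.
by rewrite -rE//; case: ltP => // /lt_trans ->.
Qed.

(** The point [i] is left out of the competitors of [j], so that the last condition constrains only
    the other [n - 2] points once [z j] is fixed; independence then factors the probability. *)
Definition leading_above (R : realType) (n : nat) (z : 'I_n -> R * R)
    (i j : 'I_n) : bool :=
  [&& right_pt (z j), (z i).2 < (z j).2 &
    [forall k, (k != i) && (k != j) ==>
      (~~ right_pt (z k) || ((z j).1 <= (z k).1))]].

(* If [j0] is the leftmost point of the right half, the pairs [(i, j0)] are
   counted exactly by the subtree at 00, and a pair [(i, j)] with [j != j0]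
   forces [i = j0] and [j] to be second from the left: at most one such pair. *)
Lemma count_left_left_pairs (R : realType) (n : nat) (z : 'I_n -> R * R)
    (c := count (prefix [:: false; false])
      (nodes (bst_points [seq z i | i <- enum 'I_n])))
    (s := (\sum_(j < n) \sum_(i < n | i != j) leading_above z i j)%N) :
  (forall i, typical_pt (z i)) -> injective (fst \o z) ->
  (exists i, right_pt (z i)) -> (exists i, ~~ right_pt (z i)) ->
  (c <= s <= c.+1)%N.
Proof.
move=> tz injz [ir hr] [il hl].
have [|||f] := @count_left_left R [seq z i | i <- enum 'I_n].
- by apply/allP => _ /mapP[i _ ->].
- by apply/hasP; exists (z ir) => //; apply/mapP; exists ir; rewrite ?mem_enum.
- by apply/hasP; exists (z il) => //; apply/mapP; exists il; rewrite ?mem_enum.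
move=> [/mapP[j0 _ ->] rj0 minj0]; rewrite -/c count_map => cE.
have {}minj0 k : right_pt (z k) -> (z j0).1 <= (z k).1.
  by apply: minj0; apply/mapP; exists k; rewrite ?mem_enum.
have cE' : c = (\sum_(i < n | i != j0) leading_above z i j0)%N.
  rewrite cE -sum1_count big_enum_cond /= big_mkcond [RHS]big_mkcond /=.
  apply: eq_bigr => i _; rewrite /leading_above rj0 /=.
  have -> : [forall k, (k != i) && (k != j0) ==>
      (~~ right_pt (z k) || ((z j0).1 <= (z k).1))].
    apply/forallP => k; apply/implyP => _.
    by case: (boolP (right_pt (z k))) => //= /minj0.
  rewrite andbT; case: eqVneq => [->|_]; first by rewrite ltxx.
  by case: ifP.
have -> : s = (c + \sum_(j < n | j != j0) \sum_(i < n | i != j)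
    leading_above z i j)%N by rewrite /s (bigD1 j0)//= -cE'.
rewrite leq_addr -addn1 leq_add2l /=.
have lead i j : j != j0 -> leading_above z i j -> i = j0.
  move=> jj0 /and3P[rj _ /forallP/(_ j0)]; rewrite rj0/= [j0 == j]eq_sym jj0 andbT.
  case: eqVneq => //= _ le; case/eqP: jj0; apply: injz => /=.
  by apply/eqP; rewrite eq_le le minj0.
apply: (@leq_trans (\sum_(j < n | j != j0) leading_above z j0 j)%N).
  apply: leq_sum => j jj0; rewrite (bigD1 j0) 1?eq_sym//= big1 ?addn0// => i.
  move=> /andP[_ ij0]; apply/eqP; rewrite eqb0; apply: contra_neqN ij0.
  exact: lead.
(* Two such [j] and [j'] would each have abscissa at most that of the other, against injectivity. *)
rewrite -big_mkcondr /= sum1_card; apply/card_le1_eqP => j j'.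
rewrite !unfold_in => /andP[jj0 /and3P[rj _ /forallP/(_ j') Hj]].
move=> /andP[jj0' /and3P[rj' _ /forallP/(_ j) Hj']].
apply/eqP/negPn/negP => jj'; move: Hj Hj'.
rewrite rj rj' jj0 jj0' [j == j']eq_sym jj' /= => Hj Hj'.
by case/eqP: jj'; apply: injz; apply/eqP; rewrite eq_le /= Hj Hj'.
Qed.

(** * Oscillating integrals *)

Lemma bounded_integrable (R : realType) d (T : measurableType d)
    (mu : {measure set T -> \bar R}) (f : T -> R) (A : set T) (M : R) :
  measurable A -> (mu A < +oo)%E -> measurable_fun setT f ->
  (forall x, A x -> `|f x| <= M) -> mu.-integrable A (EFin \o f).
Proof.
move=> mA finA mf fM; apply: measurable_bounded_integrable => //.
  exact: measurable_funTS.
by exists M; split; rewrite ?num_real// => K MK x Ax /=; rewrite (le_trans (fM x Ax))// ltW.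
Qed.

Lemma lebesgue_itv_fin (R : realType) (a b : R) :
  (@lebesgue_measure R `[a, b]%classic < +oo)%E.
Proof. by rewrite lebesgue_measure_itv/=; case: ifP => _; rewrite ?ltry. Qed.

Lemma norm_Rintegral_le (R : realType) (f : R -> R) (a b M : R) : a <= b ->
  measurable_fun setT f -> (forall x, a <= x <= b -> `|f x| <= M) ->
  `|\int[lebesgue_measure]_(x in `[a, b]) f x| <= M * (b - a).
Proof.
move=> ab mf fM.
have fi : lebesgue_measure.-integrable `[a, b] (EFin \o f).
  apply: (@bounded_integrable _ _ _ _ _ _ M) => //; first exact: lebesgue_itv_fin.
apply: le_trans; first exact: le_normr_Rintegral.
have -> : M * (b - a) = \int[lebesgue_measure]_(x in `[a, b]) M.
  rewrite Rintegral_cst//= lebesgue_measure_itv/= lte_fin; case: ltP => // ba.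
  by rewrite (_ : a = b) ?subrr//; apply/eqP; rewrite eq_le ab.
apply: le_Rintegral => //.
- apply: (@bounded_integrable _ _ _ _ _ _ M) => //; first exact: lebesgue_itv_fin.
  + exact: measurableT_comp.
  + by move=> x; rewrite /= in_itv /= normr_id => /fM.
- by apply: (@bounded_integrable _ _ _ _ _ _ `|M|) => //; exact: lebesgue_itv_fin.
Qed.

(** For [p = cos] and [p = sin] these are the real and imaginary parts of the integral of
    [(1 - x/2)^n exp(i ln x)] over [[0, 2]]. *)
Definition osc_int (R : realType) (p : R -> R) (n : nat) : R :=
  \int[lebesgue_measure]_(x in `[0, 2]) ((1 - x / 2) ^+ n * p (ln x)).

Section integration_by_parts_osc.
Variables (R : realType) (p p' : R -> R).
Hypotheses (dp : forall x : R, is_derive x 1 p (p' x))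
  (cp' : continuous p') (bp : forall x : R, `|p x| <= 1) (bp' : forall x : R, `|p' x| <= 1).

Let cp : continuous p.
Proof. by move=> x; apply: differentiable_continuous; apply/derivable1_diffP; exact: ex_derive. Qed.

Let w n (x : R) := (1 - x / 2) ^+ n.

Let cw n : continuous (w n).
Proof.
have -> : w n = (fun x => x ^+ n) \o (fun x => 1 - x / 2) by [].
move=> x; apply: continuous_comp; last exact: exprn_continuous.
by apply: cvgB; [exact: cvg_cst|apply: cvgM; [exact: cvg_id|exact: cvg_cst]].
Qed.

Let mln (q : R -> R) : continuous q -> measurable_fun setT (q \o @ln R).
Proof. by move=> cq; apply: measurableT_comp; [exact: continuous_measurable_fun|exact: measurable_ln]. Qed.

Let w1 n (x : R) : 0 <= x <= 2 -> `|w n x| <= 1.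
Proof.
by move=> x02; rewrite normrX exprn_ile1// ler_norml; lra.
Qed.

Lemma osc_integrable (q : R -> R) n : continuous q -> (forall x : R, `|q x| <= 1) ->
  lebesgue_measure.-integrable `[0, 2] (EFin \o (fun x => (1 - x / 2) ^+ n * q (ln x))).
Proof.
move=> cq bq; apply: (@bounded_integrable _ _ _ _ _ _ 1) => //.
- exact: lebesgue_itv_fin.
- by apply: measurable_funM; [exact: (continuous_measurable_fun (@cw n))|exact: mln].
- by move=> x; rewrite /= in_itv /= => /(w1 n) h; rewrite normrM mulr_ile1 ?normr_ge0//; exact: h.
Qed.

(** The factor [x] cancels the [1/x] coming from [ln], and [x/2 = 1 - (1 - x/2)] turns [x * w n']
    into [n * (w n - w n.-1)]. Thus [f] below is the derivative of [F]. *)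
Let F n (x : R) := x * w n x * p (ln x).
Let f n (x : R) :=
  n.+1%:R * (w n x * p (ln x)) + w n x * p' (ln x) -
  n%:R * (w n.-1 x * p (ln x)).

Let dF n (x : R) : 0 < x -> is_derive x 1 (F n) (f n x).
Proof.
move=> x0; have dln := is_derive1_ln x0.
have dpl : is_derive x 1 (p \o @ln R) (x^-1 * p' (ln x)).
  by rewrite mulrC; exact: is_derive1_comp.
have dw : is_derive x 1 (w n) (- (2^-1 * n%:R * w n.-1 x)).
  have d1 : is_derive x 1 (fun x : R => 1 - x / 2) (- 2^-1).
    have -> : (fun x : R => 1 - x / 2) = cst 1 - 2^-1 \*: (@id R).
      by apply/funext => y; rewrite !fctE /= [_ *: _]mulrC.
    by apply: is_derive_eq; rewrite sub0r [_ *: _]mulr1.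
  have -> : w n = (fun x : R => 1 - x / 2) ^+ n by rewrite exprfctE.
  by apply: is_derive_eq; rewrite [_ *: _]mulrN mulrC mulrA.
change (is_derive x 1 ((@id R * w n) * (p \o @ln R)) (f n x)).
apply: is_derive_eq.
rewrite /f /GRing.scale !fctE /=.
have xN0 : x != 0 by exact: lt0r_neq0.
clear dw; case: n => [|n] /=; first by field.
have -> : w n.+1 x = (1 - x / 2) * w n x by rewrite /w exprS.
by rewrite -[n.+2%:R]natr1; field.
Qed.

(** The derivative of [F n] integrates to [F n 2]. As [ln] is singular at 0, the fundamental theorem
    is applied on [[e, 2]], and [e] is then sent to 0. The right side vanishes for [n >= 1] and
    equals [2 * p (ln 2)] for [n = 0]. *)
Lemma osc_int_parts n :
  n.+1%:R * osc_int p n + osc_int p' n - n%:R * osc_int p n.-1 = 2 * (1 - 2 / 2) ^+ n * p (ln 2).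
Proof.
have mf : measurable_fun setT (f n).
  apply: measurable_funB; first apply: measurable_funD.
  - by do 2?apply: measurable_funM => //; [exact: continuous_measurable_fun|exact: mln].
  - by apply: measurable_funM => //; [exact: continuous_measurable_fun|exact: mln].
  - by do 2?apply: measurable_funM => //; [exact: continuous_measurable_fun|exact: mln].
pose M : R := n.+1%:R + 1 + n%:R.
have M0 : 0 <= M by rewrite !addr_ge0.
have wp (q : R -> R) m (x : R) : 0 <= x <= 2 -> (forall x : R, `|q x| <= 1) ->
    `|w m x * q (ln x)| <= 1.
  by move=> x02 bq; rewrite normrM mulr_ile1// w1.
have fM (x : R) : 0 <= x <= 2 -> `|f n x| <= M.
  move=> x02; apply: (le_trans (ler_normB _ _)); apply: lerD; last first.
    by rewrite normrM normr_nat ler_piMr// wp.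
  apply: (le_trans (ler_normD _ _)); apply: lerD; last exact: wp.
  by rewrite normrM normr_nat ler_piMr// wp.
have fi : lebesgue_measure.-integrable `[0, 2] (EFin \o f n).
  apply: (@bounded_integrable _ _ _ _ _ _ M) => //; first exact: lebesgue_itv_fin.
have intf : \int[lebesgue_measure]_(x in `[0, 2]) f n x =
    n.+1%:R * osc_int p n + osc_int p' n - n%:R * osc_int p n.-1.
  have ip m : lebesgue_measure.-integrable `[0, 2] (EFin \o (fun x => w m x * p (ln x))).
    exact: osc_integrable.
  have ip' m : lebesgue_measure.-integrable `[0, 2] (EFin \o (fun x => w m x * p' (ln x))).
    exact: osc_integrable.
  have iZ (c : R) m : lebesgue_measure.-integrable `[0, 2]
      (EFin \o (fun x => c * (w m x * p (ln x)))).
    exact: (integrableZl _ _ (ip m)).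
  rewrite /f RintegralB//; last exact: (integrableD _ (iZ _ _) (ip' _)).
  by rewrite RintegralD// !RintegralZl.
have ftc (e : R) : 0 < e < 2 -> \int[lebesgue_measure]_(x in `[e, 2]) f n x = F n 2 - F n e.
  move=> /andP[e0 e2]; rewrite /Rintegral (@continuous_FTC2 _ (f n) (F n))//.
  - apply: continuous_in_subspaceT => x; rewrite inE/= in_itv/= => /andP[ex _].
    have cln (q : R -> R) : continuous q -> {for x, continuous (q \o @ln R)}.
      move=> cq; apply: continuous_comp; last exact: cq.
      by apply: continuous_ln; exact: lt_le_trans ex.
    have cM m (q : R -> R) : continuous q -> (fun x => w m x * q (ln x)) @ x --> w m x * q (ln x).
      by move=> cq; apply: cvgM; [exact: cw|exact: cln].
    by apply: cvgB; [apply: cvgD|]; do ?[apply: cvgM; first exact: cvg_cst]; exact: cM.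
  - have dd (x : R) : e <= x -> derivable (F n) x 1.
      by move=> ex; apply: ex_derive; apply: dF; exact: lt_le_trans ex.
    have cc (x : R) : e <= x -> F n @ x --> F n x.
      by move=> ex; apply: differentiable_continuous; apply/derivable1_diffP; exact: dd.
    split.
    + by move=> x; rewrite in_itv/= => /andP[/ltW ex _]; exact: dd.
    + exact/cvg_at_right_filter/cc.
    + by apply/cvg_at_left_filter/cc; exact: ltW.
  - move=> x; rewrite in_itv/= => /andP[ex _]; rewrite derive1E.
    by apply: derive_val; apply: dF; exact: lt_trans ex.
rewrite -intf -[RHS]/(F n 2).
apply/eqP; rewrite -subr_eq0 -normr_le0; apply/ler_addgt0Pr => d d0; rewrite add0r.
(* The integral over [[0, e]] costs at most [M * e] and the boundary term [F n e] at most [e];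
   together at most [d]. *)
pose e := Num.min 1 (d / (M + 1)).
have e0 : 0 < e by rewrite lt_min ltr01 divr_gt0// ltr_wpDl.
have e1 : e <= 1 by rewrite ge_min lexx.
have ed : (M + 1) * e <= d.
  by rewrite mulrC -ler_pdivlMr ?ltr_wpDl// ge_min lexx orbT.
have e2 : 0 < e < 2 by rewrite e0 (le_lt_trans e1)// ltr1n.
have := @Rintegral_itvB R (f n) (BLeft 0) (BRight 2) e fi.
rewrite !bnd_simp (ltW e0) (ltW (andP e2).2) => /(_ isT isT).
rewrite Rintegral_itv_obnd_cbnd; last first.
  apply: (integrableS _ _ _ fi) => //; apply: subset_itvr; rewrite bnd_simp; exact: ltW.
rewrite ftc// => /eqP; rewrite subr_eq => /eqP ->.
rewrite (_ : _ - _ = \int[lebesgue_measure]_(x in `[0, e]) f n x - F n e); last by ring.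
apply: le_trans ed; apply: (le_trans (ler_normB _ _)); rewrite mulrDl mul1r; apply: lerD.
  rewrite -[in leRHS](subr0 e); apply: norm_Rintegral_le => //; first exact: ltW.
  by move=> x /andP[x0 xe]; apply: fM; rewrite x0 (le_trans xe)// (le_trans e1)// ler1n.
rewrite /F -mulrA normrM ger0_norm ?(ltW e0)// ler_piMr ?(ltW e0)// wp//.
by rewrite (ltW e0) ltW//; case/andP: e2.
Qed.

End integration_by_parts_osc.

Lemma osc_intN (R : realType) (q : R -> R) n :
  continuous q -> (forall x : R, `|q x| <= 1) ->
  osc_int (fun x => - q x) n = - osc_int q n.
Proof.
move=> cq bq; rewrite /osc_int -mulN1r -RintegralZl//; last exact: osc_integrable.
by apply: eq_Rintegral => x _; rewrite mulrN mulN1r.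
Qed.

(** Integration by parts for [(sin, cos)] and for [(cos, - sin)] gives, from rank 1 on, the two
    recurrences of a rotating sequence. *)
Lemma osc_int_sin_not_cvg (R : realType) :
  ~ cvgn (fun n => n.+1%:R * osc_int (@sin R) n).
Proof.
have bs (x : R) : `|sin x| <= 1 by rewrite ler_norml sin_geN1 sin_le1.
have bc (x : R) : `|cos x| <= 1 by rewrite ler_norml cos_geN1 cos_le1.
have bNs (x : R) : `|- sin x| <= 1 by rewrite normrN.
have cNs : continuous (fun x : R => - sin x).
  by move=> x; apply: cvgN; exact: continuous_sin.
have ps := @osc_int_parts R _ _ (@is_derive_sin R) (@continuous_cos R) bs bc.
have pc := @osc_int_parts R _ _ (@is_derive_cos R) cNs bc bNs.
have {}pc n := etrans (congr1 (fun u => _ * _ + u - _) (esym (osc_intN n (@continuous_sin R) bs))) (pc n).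
apply: (@rotating_sequence_not_cvg R _ (fun n => n.+1%:R * osc_int (@cos R) n)).
- move=> n; rewrite [_ * osc_int cos _]mulrC mulfK//.
  by have := ps n.+1; rewrite divff// subrr expr0n mulr0 mul0r; lra.
- move=> n; rewrite [_ * osc_int sin _]mulrC mulfK//.
  by have := pc n.+1; rewrite divff// subrr expr0n mulr0 mul0r; lra.
rewrite !mul1r.
(* At rank 0 the boundary terms are [2 sin (ln 2)] and [2 cos (ln 2)]. Their squares add up to 4, so
   the initial modulus is nonzero. *)
have := pc 0%N; have := ps 0%N; rewrite !expr0 !mul0r !mul1r !subr0 !mulr1 => h1 h2.
have : (osc_int sin 0 + osc_int cos 0) ^+ 2 + (osc_int cos 0 - osc_int sin 0) ^+ 2 = 4 :> R.
  rewrite h1 h2 !exprMn -mulrDr addrC cos2Dsin2; lra.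
by rewrite !expr2; nra.
Qed.

(** * Independence *)

Section independence.
Local Open Scope ereal_scope.
Context (R : realType) d (Om : measurableType d) (P : probability Om R).

(** Both sides are finite measures in [A], the law of [X] restricted to [F] and a multiple of the
    law of [X]; they agree on a generating pi-system. *)
Lemma indep_generator d' (T : measurableType d') (G : set (set T))
    (g : (set T)^nat) (X : {mfun Om >-> T}) (F : set Om) :
  measurable = <<s G>> -> setI_closed G -> (forall i, G (g i)) ->
  \bigcup_k g k = setT -> measurable F ->
  (forall A, G A -> P (X @^-1` A `&` F) = P F * P (X @^-1` A)) ->
  forall A, measurable A -> P (X @^-1` A `&` F) = P F * P (X @^-1` A).
Proof.
move=> mG IG Gg gT mF h.
have PF : P F = (fine (P F))%:E by rewrite fineK// fin_num_measure.
have PF0 : (0 <= fine (P F))%R by rewrite fine_ge0.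
pose m0 : {measure set T -> \bar R} := pushforward (mrestr P mF) X.
pose m1 := m0 (measurable_funPT X).
pose m2 : {measure set T -> \bar R} := mscale (NngNum PF0) (distribution P X).
have m12 A : G A -> m1 A = m2 A.
  by move=> /h GA; rewrite /m1 /m0 /m2 /= /mscale /mrestr /distribution /pushforward /= -PF.
move=> A mA; suff : m1 A = m2 A.
  by rewrite /m1 /m0 /m2 /= /mscale /mrestr /distribution /pushforward /= -PF.
apply: (measure_unique G g mG IG Gg gT m1 m2 m12 _ A mA) => k.
rewrite (le_lt_trans (probability_le1 P _)) ?ltry//.
apply: measurableI => //; apply: measurable_funPTI => //.
rewrite mG; exact: sub_sigma_algebra.
Qed.

(** The hypothesis on rectangles makes the law of [(X, V)] the product of [mu] and the law of [V],
    which is computed by sections. *)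
Lemma indep_section d1 d2 (T1 : measurableType d1) (T2 : measurableType d2)
    (mu : probability T1 R) (X : Om -> T1) (V : {mfun Om >-> T2})
    (E : set (T1 * T2)) :
  measurable_fun setT X -> 
  (forall A B, measurable A -> measurable B ->
    P (X @^-1` A `&` V @^-1` B) = mu A * P (V @^-1` B)) ->
  measurable E ->
  P [set w | E (X w, V w)] = \int[mu]_x P (V @^-1` (xsection E x)).
Proof.
move=> mX h mE.
have mXV : measurable_fun setT (fun w => (X w, V w)) by exact: measurable_fun_pair.
pose XV : {mfun Om >-> (T1 * T2)%type} := HB.pack (fun w => (X w, V w))
  (isMeasurableFun.Build _ _ _ _ _ mXV).
pose m' : {measure set (T1 * T2) -> \bar R} := distribution P XV.
have m'E A B : measurable A -> measurable B ->
    m' (A `*` B) = mu A * distribution P V B by exact: h.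
exact: (esym (@product_measure_unique _ _ _ _ R mu (distribution P V) m' m'E E mE)).
Qed.
End independence.

Lemma measurable_bool_set d (T : measurableType d) (b : T -> bool) :
  measurable_fun setT b -> measurable [set x | b x].
Proof.
move=> mb; have := mb measurableT [set true] Logic.I; rewrite setTI.
by congr measurable; apply/seteqP; split => x /=; case: (b x).
Qed.

(* The junk value 2 exceeds every abscissa in the square, so that points of the
   left half do not affect [right_min]. *)
Definition right_coord (R : realType) (p : R * R) : R :=
  if right_pt p then p.1 else 2.

(** Turns the quantified condition of [leading_above] into a comparison of [(z j).1] with one real
    random variable, a function of the other [n - 2] points. *)
Definition right_min (R : realType) (n : nat) (z : 'I_n -> R * R)
    (i j : 'I_n) : R :=
  \big[Num.min/2]_(k | (k != i) && (k != j)) right_coord (z k).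

Definition in_square (R : realType) (p : R * R) : bool :=
  [&& 0 <= p.1, p.1 <= 1, 0 <= p.2 & p.2 <= 1].

Lemma measurable_in_square (R : realType) : measurable_fun setT (@in_square R).
Proof. by do !apply: measurable_and; exact: measurable_fun_ler. Qed.

Lemma measurable_right_pt (R : realType) : measurable_fun setT (@right_pt R).
Proof.
by apply: measurable_fun_ltr; [exact: measurable_cst|exact: measurable_fst].
Qed.

Lemma measurable_right_coord (R : realType) :
  measurable_fun setT (@right_coord R).
Proof.
apply: measurable_fun_ifT; [exact: measurable_right_pt|exact: measurable_fst|].
exact: measurable_cst.
Qed.

Section iid_pairs.
Local Open Scope ereal_scope.
Context (R : realType) d (Om : measurableType d) (P : probability Om R)
  (mu : probability (R * R)%type R) (n : nat)
  (Z : 'I_n -> {RV P >-> (R * R)%type}).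
Hypothesis iid : iid_points mu Z.

Let law i (A : set (R * R)) : measurable A -> P (Z i @^-1` A) = mu A.
Proof. by move=> mA; rewrite -(iid.1 i A mA). Qed.

Variables (i j : 'I_n).
Hypothesis ij : i != j.

Let W w := right_min (fun k => Z k w) i j.

Lemma measurable_right_min :
  measurable_fun setT (fun w => right_min (fun k => Z k w) i j).
Proof.
rewrite /right_min; elim: (index_enum _) => [|k s IH].
  rewrite (_ : (fun w => _) = cst 2%R); first exact: measurable_cst.
  by apply/funext => w; rewrite big_nil.
pose m w := \big[Num.min/2%R]_(k <- s | (k != i) && (k != j)) right_coord (Z k w).
rewrite (_ : (fun w => _) = if (k != i) && (k != j)
    then (fun w => right_coord (Z k w)) \min m else m); last first.
  by apply/funext => w; rewrite big_cons; case: ifP.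
case: ifP => // _; apply: measurable_minr => //.
by apply: measurableT_comp => //; exact: measurable_right_coord.
Qed.

Let mW : measurable_fun setT W := measurable_right_min.

Let C t := [set p : R * R | (t <= right_coord p)%R].

Let mC t : measurable (C t).
Proof.
apply: measurable_bool_set; apply: measurable_fun_ler; first exact: measurable_cst.
exact: measurable_right_coord.
Qed.

Lemma iid_rect (A A' B : set (R * R)) :
  measurable A -> measurable A' -> measurable B ->
  P [set w | [/\ A (Z j w), A' (Z i w) &
    forall k, (k != i) && (k != j) -> B (Z k w)]] =
  mu A * mu A' * (fine (mu B) ^+ n.-2)%:E.
Proof.
move=> mA mA' mB.
pose D k := if k == j then A else if k == i then A' else B.
have mD k : measurable (D k) by rewrite /D; case: ifP => // _; case: ifP.
transitivity (P [set w | forall k, D k (Z k w)]).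
  congr (P _); apply/seteqP; split => w /=.
    move=> [Aj Ai Bk] k; rewrite /D; case: eqVneq => [->//|kj].
    by case: eqVneq => [->//|ki]; apply: Bk; rewrite ki kj.
  move=> h; split; first by have := h j; rewrite /D eqxx.
    by have := h i; rewrite /D (negbTE ij) eqxx.
  by move=> k /andP[ki kj]; have := h k; rewrite /D (negbTE ki) (negbTE kj).
rewrite iid.2// (eq_bigr (fun k => mu (D k))); last by move=> k _; exact: law.
rewrite (bigD1 j)//= (bigD1 i)//= /D eqxx (negbTE ij) eqxx muleA; congr (_ * _).
rewrite (eq_bigr (fun=> (fine (mu B))%:E)); last first.
  by move=> k /andP[kj ki]; rewrite (negbTE kj) (negbTE ki) fineK ?fin_num_measure.
rewrite prodEFin prodr_const; congr (_ ^+ _)%:E.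
have := cardC (pred2 j i); rewrite card2 eq_sym ij card_ord => nE.
transitivity (1 + 1 + #|[predC pred2 j i]|).-2; last by rewrite nE.
by apply: eq_card => k; rewrite !inE negb_or.
Qed.

Let rayE (A A' : set (R * R)) t : measurable A -> measurable A' -> (t <= 2)%R ->
  P [set w | [/\ A (Z j w), A' (Z i w) & (t <= W w)%R]] =
  mu A * mu A' * (fine (mu (C t)) ^+ n.-2)%:E.
Proof.
move=> mA mA' t2; rewrite -iid_rect//; congr (P _); apply/seteqP; split => w /=.
  by move=> [? ? /bigmin_geP[_ h]]; split.
by move=> [? ? h]; split => //; apply/bigmin_geP.
Qed.

Let WV : {mfun Om >-> R} := HB.pack W (isMeasurableFun.Build _ _ _ _ _ mW).

(** The rays [[t, +oo[] form a generating pi-system. For [t <= 2] the event [t <= W] is an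
    intersection over the other points; for [t > 2] it is empty because [W <= 2]. *)
Let indepW (A A' : set (R * R)) (B : set R) :
  measurable A -> measurable A' -> measurable B ->
  P [set w | [/\ A (Z j w), A' (Z i w) & B (W w)]] = mu A * mu A' * P (W @^-1` B).
Proof.
move=> mA mA' mB.
pose F := Z j @^-1` A `&` Z i @^-1` A'.
have mF : measurable F by apply: measurableI; exact: measurable_funPTI.
have PFE : P F = mu A * mu A'.
  have := @iid_rect A A' setT mA mA' measurableT.
  rewrite probability_setT expr1n mule1 => <-.
  by congr (P _); apply/seteqP; split => w /=; [case|case].
rewrite -PFE.
have -> : [set w | [/\ A (Z j w), A' (Z i w) & B (W w)]] = WV @^-1` B `&` F.
  by apply/seteqP; split => w /=; [case|case => ? []].
apply: (@indep_generator _ _ _ P _ _ (@RGenCInfty.G R) (fun k => `[(- k%:R)%R, +oo[%classic) WV F) => //.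
- exact: RGenCInfty.measurableE.
- move=> _ _ [s ->] [t ->]; exists (Num.max s t).
  by apply/seteqP; split => x /=; rewrite !in_itv/= !andbT ge_max => /andP.
- by move=> k; eexists.
- apply/seteqP; split => // x _; exists (Num.truncn `|x|).+1 => //=.
  rewrite in_itv/= andbT lerNl; apply: (le_trans (ler_norm _)); rewrite normrN.
  by apply: ltW; exact: truncnS_gt.
move=> _ [t ->]; have [t2|t2] := leP t 2%R.
  have -> : WV @^-1` `[t, +oo[%classic `&` F = [set w | [/\ A (Z j w), A' (Z i w) & (t <= W w)%R]].
    by apply/seteqP; split => w /=; rewrite in_itv/= andbT; [case => ? []|case].
  have -> : WV @^-1` `[t, +oo[%classic = [set w | [/\ setT (Z j w), setT (Z i w) & (t <= W w)%R]].
    by apply/seteqP; split => w /=; rewrite in_itv/= andbT; [split|case].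
  by rewrite !rayE// probability_setT !mul1e PFE.
have -> : WV @^-1` `[t, +oo[%classic = set0.
  apply/seteqP; split => w //=; rewrite in_itv/= andbT.
  by move=> /bigmin_geP[]; rewrite leNgt t2.
by rewrite set0I !measure0 mule0.
Qed.

(** The components stand for [Z j] and for the pair of [Z i] and the minimum, so that a section
    fixes the value of [Z j]. [in_square] keeps its abscissa below the default 2. *)
Definition pair_event : set (R * R * ((R * R) * R)) :=
  [set u | [&& right_pt u.1, in_square u.1, (u.2.1.2 < u.1.2)%R & (u.1.1 <= u.2.2)%R]].

Let mV : measurable_fun setT (fun w => (Z i w, W w)).
Proof. exact: measurable_fun_pair. Qed.

Let V : {mfun Om >-> ((R * R) * R)%type} := HB.pack (fun w => (Z i w, W w))
  (isMeasurableFun.Build _ _ _ _ _ mV).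

Lemma measurable_pair_event : measurable pair_event.
Proof.
have m11 : measurable_fun setT (fun u : R * R * ((R * R) * R) => u.1.1).
  exact: measurableT_comp measurable_fst measurable_fst.
apply: measurable_bool_set; apply: measurable_and.
  exact: measurableT_comp (@measurable_right_pt R) measurable_fst.
apply: measurable_and.
  exact: measurableT_comp (@measurable_in_square R) measurable_fst.
apply: measurable_and.
  apply: measurable_fun_ltr.
    apply: measurableT_comp; first exact: measurable_snd.
    exact: measurableT_comp measurable_fst measurable_snd.
  exact: measurableT_comp measurable_snd measurable_fst.
apply: measurable_fun_ler => //.
exact: measurableT_comp measurable_snd measurable_snd.
Qed.

(** Given [Z j = z], the point [i] must lie below [z] and each of the other [n - 2] points must
    avoid the strip between abscissae 1/2 and [z.1]; these conditions are independent. *)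
Lemma prob_pair_event :
  P [set w | pair_event (Z j w, (Z i w, right_min (fun k => Z k w) i j))] =
  \int[mu]_z (if right_pt z && in_square z then
    mu [set p | (p.2 < z.2)%R] *
    (fine (mu [set p | ~~ right_pt p || (z.1 <= p.1)%R]) ^+ n.-2)%:E else 0).
Proof.
have mb y : measurable [set p : R * R | (p.2 < y)%R].
  by apply: measurable_bool_set; apply: measurable_fun_ltr.
rewrite (@indep_section _ _ _ P _ _ _ _ mu (Z j) V pair_event)//; last 2 first.
- move=> A B mA mB; rewrite setIC.
  have PA : P (Z j @^-1` A) = mu A by exact: law.
  rewrite -PA.
  apply: (@indep_generator _ _ _ _ _ _ [set X `*` Y | X in measurable & Y in measurable] (fun=> setT) V (Z j @^-1` A)) => //.
  + exact: measurable_prod_measurableType.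
  + move=> _ _ [X1 mX1 [X2 mX2 <-]] [Y1 mY1 [Y2 mY2 <-]].
    rewrite -setXI; exists (X1 `&` Y1); first exact: measurableI.
    by exists (X2 `&` Y2) => //; exact: measurableI.
  + by move=> _; exists setT => //; exists setT => //; rewrite setXTT.
  + by rewrite bigcup_const //; exists 0%N.
  + exact: measurable_funPTI.
  move=> _ [X mX [Y mY <-]].
  have -> : V @^-1` (X `*` Y) `&` Z j @^-1` A =
      [set w | [/\ A (Z j w), X (Z i w) & Y (W w)]].
    by apply/seteqP; split => w /=; [case => -[]|case].
  have -> : V @^-1` (X `*` Y) =
      [set w | [/\ setT (Z j w), X (Z i w) & Y (W w)]].
    by apply/seteqP; split => w /=; [case|case].
  by rewrite !indepW// PA probability_setT mul1e muleA.
- exact: measurable_pair_event.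
apply: eq_integral => z _; case: ifPn => [/andP[rz sz]|nz]; last first.
  rewrite (_ : xsection _ _ = set0) ?preimage_set0 ?measure0//.
  apply/seteqP; split => u //=; rewrite /xsection/= inE /pair_event /=.
  by case/and4P => rz sz; rewrite rz sz in nz.
have z1 : (z.1 <= 1)%R by case/and4P: sz.
have -> : V @^-1` xsection pair_event z =
    [set w | [/\ setT (Z j w), [set p | (p.2 < z.2)%R] (Z i w) & (z.1 <= W w)%R]].
  apply/seteqP; split => w /=; rewrite /xsection/= inE /pair_event /= rz sz /=.
    by move=> /andP[].
  by case=> _ -> ->.
rewrite rayE//; last by rewrite (le_trans z1)// ler1n.
rewrite probability_setT mul1e; congr (_ * (fine (mu _) ^+ _)%:E).
apply/seteqP; split => p /=; rewrite /C /= /right_coord; case: ifP => //= _ _.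
by rewrite (le_trans z1)// ler1n.
Qed.

End iid_pairs.

(** * The two permutons *)

Section permuton_marginals.
Local Open Scope ereal_scope.
Context (R : realType).

Lemma uniform_probE (A : set R) : measurable A ->
  uniform_prob (@ltr01 R) A = lebesgue_measure (A `&` `[0%R, 1%R]).
Proof.
move=> mA; rewrite /uniform_prob integral_uniform_pdf.
rewrite (eq_integral (cst 1)); last first.
  move=> x; rewrite inE /= in_itv /= => -[_ x01].
  by rewrite /uniform_pdf x01 subr0 invr1.
by rewrite integral_cst ?mul1e//; exact: measurableI.
Qed.

Context (mu : probability (R * R)%type R).
Hypothesis hmu : permuton mu.

Lemma permuton_below y : (0 <= y <= 1)%R -> mu [set p | (p.2 < y)%R] = y%:E.
Proof.
move=> /andP[y0 y1]; case: hmu => _ _ hy.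
rewrite (_ : [set p | _] = snd @^-1` `]-oo, y[%classic); last first.
  by apply/seteqP; split => p; rewrite /= in_itv.
rewrite hy// uniform_probE// (_ : _ `&` _ = `[0%R, y[%classic).
  by rewrite lebesgue_measure_itv/= lte_fin oppr0 adde0; case: ltP => // y0'; congr EFin; apply/eqP; rewrite eq_le y0.
apply/seteqP; split => x /=; rewrite !in_itv/= ?in_itv/=; first by case=> -> /andP[->].
by move=> /andP[x0 xy]; rewrite x0 xy ltW// (lt_le_trans xy).
Qed.

Lemma permuton_strip x : (2^-1 < x <= 1)%R ->
  mu [set p | ~~ right_pt p || (x <= p.1)%R] = (3 / 2 - x)%:E.
Proof.
move=> /andP[x2 x1]; case: hmu => _ hx _.
rewrite (_ : [set p | _] = ~` (fst @^-1` `]2^-1%R, x[%classic)); last first.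
  apply/seteqP; split => p; rewrite /= in_itv/= /right_pt.
    by move=> /orP[/negbTE -> //|xp] /andP[_]; rewrite ltNge xp.
  by move=> /negP; rewrite negb_and -[in X in _ || X -> _]leNgt.
rewrite probability_setC; last first.
  by rewrite -[X in measurable X]setTI; exact: measurable_fst.
rewrite hx// uniform_probE// (_ : _ `&` _ = `]2^-1%R, x[%classic).
  by rewrite lebesgue_measure_itv/= lte_fin x2 -!EFinB; congr EFin; lra.
apply/seteqP; split => u /=; rewrite !in_itv/= ?in_itv/=; first by case.
by move=> /andP[u0 u1]; rewrite u0 u1; split => //; lra.
Qed.

Lemma permuton_left : mu [set p | ~~ right_pt p] = 2^-1%:E.
Proof.
case: hmu => _ hx _.
rewrite (_ : [set p | _] = fst @^-1` `]-oo, 2^-1%R]%classic); last first.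
  by apply/seteqP; split => p; rewrite /= in_itv/= /right_pt leNgt.
rewrite hx// uniform_probE// (_ : _ `&` _ = `[0%R, 2^-1%R]%classic).
  by rewrite lebesgue_measure_itv/= lte_fin invr_gt0 ltr0n oppr0 adde0.
by apply/seteqP; split => u /=; rewrite !in_itv/= ?in_itv/=; [case; lra|split; lra].
Qed.

Lemma permuton_right : mu [set p | right_pt p] = 2^-1%:E.
Proof.
rewrite (_ : [set p | _] = ~` [set p | ~~ right_pt p]); last first.
  by apply/seteqP; split => p /=; [move=> ->|move/negP/negPn].
rewrite probability_setC ?permuton_left -?EFinB; first by congr EFin; lra.
by apply: measurable_bool_set; apply: measurable_neg; exact: measurable_right_pt.
Qed.

Lemma permuton_vertical_line x : mu [set p | p.1 == x] = 0.
Proof.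
case: hmu => _ hx _.
rewrite (_ : [set p | _] = fst @^-1` [set x]); last first.
  by apply/seteqP; split => p /eqP.
rewrite hx// uniform_probE//; apply/eqP; rewrite eq_le measure_ge0 andbT.
rewrite -(lebesgue_measure_set1 x); apply: le_measure; rewrite ?inE//.
by apply: measurableI.
Qed.

(** By uniformity of the marginals, [z.2] is the mass below [z] and [3/2 - z.1 = 1 - (z.1 - 1/2)] is
    the mass outside the strip. *)
Definition pair_density (m : nat) (z : R * R) : R :=
  (if right_pt z then z.2 * (3 / 2 - z.1) ^+ m else 0)%R.

Lemma prob_pair_eventE d (Om : measurableType d) (P : probability Om R) n
    (Z : 'I_n -> {RV P >-> (R * R)%type}) (i j : 'I_n) :
  iid_points mu Z -> i != j ->
  P [set w | @pair_event R (Z j w, (Z i w, right_min (fun k => Z k w) i j))] =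
  \int[mu]_(z in @unit_square R) (pair_density n.-2 z)%:E.
Proof.
move=> iid ij; rewrite (prob_pair_event iid ij) [RHS]integral_mkcond.
apply: eq_integral => z _; rewrite patchE.
have -> : (z \in @unit_square R) = in_square z.
  by apply/idP/idP; rewrite inE /unit_square /= !in_itv/= /in_square;
    [case=> /andP[-> ->] /andP[-> ->]|case/and4P => -> -> -> ->].
case: (boolP (in_square z)) => [/and4P[x0 x1 y0 y1]|]; last by rewrite andbF.
rewrite andbT /pair_density; case: ifPn => // rz.
by rewrite permuton_below ?y0// permuton_strip ?x1 ?andbT.
Qed.

End permuton_marginals.

(** * The contribution of one pair, computed from the density *)

Lemma integral_density (R : realType) d (T : measurableType d)
    (mu : {sigma_finite_measure set T -> \bar R}) (nu : probability T R)
    (f g : T -> R) (D : set T) :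
  measurable D -> measurable_fun setT f -> (forall x, 0 <= f x) ->
  (forall A, measurable A -> nu A = (\int[mu]_(x in A) (f x)%:E)%E) ->
  measurable_fun setT g -> nu.-integrable D (EFin \o g) ->
  (\int[nu]_(x in D) (g x)%:E = \int[mu]_(x in D) (g x * f x)%:E)%E.
Proof.
move=> mD mf f0 nuE mg ig.
(* Domination yields a Radon-Nikodym derivative; it equals [f] almost everywhere, since both have
   the same integral over every measurable set. *)
have dom : nu `<< mu.
  by apply/null_content_dominatesP => A mA A0; rewrite nuE// null_set_integral//;
    apply/measurable_EFinP; exact: measurable_funTS.
have fi : mu.-integrable setT (EFin \o f).
  apply/integrableP; split; first exact/measurable_EFinP.
  rewrite (eq_integral (EFin \o f)); last first.
    by move=> x _; rewrite /= ger0_norm.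
  by rewrite -nuE// probability_setT ltry.
rewrite -(Radon_Nikodym_change_of_variables dom mD ig).
apply: ae_eq_integral => //.
- apply: emeasurable_funM; first exact/measurable_EFinP/measurable_funTS.
  apply: (measurable_int mu); apply: (integrableS _ _ (@subsetT _ _)) => //.
  exact: Radon_Nikodym_integrable.
- by apply/measurable_EFinP/measurable_funTS; exact: measurable_funM.
under [X in ae_eq _ _ _ X]eq_fun do rewrite EFinM.
apply: ae_eqe_mul2l => /=; rewrite Radon_NikodymE//=.
case: cid => /= h [h1 h2 h3].
apply: integral_ae_eq => //=.
- exact: integrableS h2.
- by apply/measurable_EFinP/measurable_funTS.
by move=> E _ mE; rewrite -h3//= nuE.
Qed.

Lemma lebesgue_square_sigma_finite (R : realType) :
  sigma_finite setT (@lebesgue_measure R \x @lebesgue_measure R)%E.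
Proof.
pose I (n : nat) : set R := `[- n%:R, n%:R]%classic.
exists (fun n => I n `*` I n).
  apply/esym; apply/seteqP; split => // -[x y] _.
  pose n := (Num.truncn (Num.max `|x| `|y|)).+1.
  have : Num.max `|x| `|y| <= n%:R by apply/ltW; exact: truncnS_gt.
  rewrite ge_max !ler_norml => /andP[hx hy].
  by exists n => //; split; rewrite /I/= in_itv.
move=> n; have mI : measurable (I n : set (measurableTypeR R)) by exact: measurable_itv.
split; first exact: measurableX.
rewrite product_measure1E//.
have fin : (@lebesgue_measure R (I n) < +oo)%E.
  by rewrite lebesgue_measure_itv/=; case: ifP => _; rewrite ?ltry.
by rewrite lte_mul_pinfty// ge0_fin_numE.
Qed.

Lemma measurable_sin_ln (R : realType) : measurable_fun setT (fun x : R => sin (ln x)).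
Proof.
apply: measurableT_comp; last exact: measurable_ln.
by apply: continuous_measurable_fun; exact: continuous_sin.
Qed.

Lemma sin_norm_le1 (R : realType) (x : R) : `|sin x| <= 1.
Proof. by rewrite ler_norml sin_geN1 sin_le1. Qed.

Lemma dens_const_norm (R : realType) : `|dens_const R| <= 1.
Proof.
rewrite /dens_const normrM ger0_norm// mulrC -ler_pdivlMr//.
have := @norm_Rintegral_le R (fun x => sin (ln x)) 0 2^-1 1 _ (@measurable_sin_ln R).
rewrite subr0; apply; first by rewrite invr_ge0.
by move=> x _; exact: sin_norm_le1.
Qed.

Lemma measurable_density1 (R : realType) : measurable_fun setT (@density1 R).
Proof.
have ml a b (h : R * R -> R) : measurable_fun setT h ->
    measurable_fun setT (fun z => (a < h z) && (h z < b)).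
  by move=> mh; apply: measurable_and; exact: measurable_fun_ltr.
have m1 a b := ml a b (fun z => z.1) measurable_fst.
have m2 a b := ml a b (fun z => z.2) measurable_snd.
rewrite (_ : @density1 R = fun z => if (0 < z.1 < 2^-1) && (0 < z.2 < 2^-1) then 1 + sin (ln z.1)
  else if (0 < z.1 < 2^-1) && (2^-1 < z.2 < 1) then 1 - sin (ln z.1)
  else if (2^-1 < z.1 < 1) && (0 < z.2 < 2^-1) then 1 - dens_const R
  else if (2^-1 < z.1 < 1) && (2^-1 < z.2 < 1) then 1 + dens_const R
  else 0); last by apply/funext => -[].
have ms : measurable_fun setT (fun z : R * R => sin (ln z.1)).
  exact: (measurableT_comp (@measurable_sin_ln R) measurable_fst).
do 4?[apply: measurable_fun_ifT => //; first exact: (measurable_and (m1 _ _) (m2 _ _))].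
- exact: measurable_funD.
- exact: measurable_funB.
Qed.

Lemma density1_ge0 (R : realType) (z : R * R) : 0 <= density1 z.
Proof.
have := @dens_const_norm R; rewrite ler_norml => /andP[c1 c2].
rewrite /density1; case: z => x y.
have := @sin_norm_le1 R (ln x); rewrite ler_norml => /andP[s1 s2].
by do 4?[case: ifP => _; first by lra].
Qed.

(** The diagonal part carries only abscissae at most 1/2, where [pair_density] vanishes. In the
    other part one factor 1/2 comes from the weight of [mu1] and one from the height [y/2]. *)
Lemma integral_pair_density (R : realType) (mu1 mu2 : probability (R * R)%type R)
    (m : nat) : char2 mu1 mu2 ->
  (\int[mu2]_(z in @unit_square R) (pair_density m z)%:E =
   \int[mu1]_(z in @unit_square R)
     (if (0 < z.1)%R then 4^-1 * (z.2 * (1 - z.1 / 2) ^+ m) else 0)%R%:E)%E.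
Proof.
move=> hchar; rewrite hchar.
- rewrite [X in (X + _)%E](_ : _ = 0%E) ?add0e; last first.
    apply: integral0_eq => t; rewrite /= in_itv/= => /andP[_ t2].
    by rewrite /pair_density /right_pt/= ltNge t2.
  apply: eq_integral => z _; rewrite /pair_density /right_pt /=.
  have -> : (2^-1 < (z.1 + 1) / 2) = (0 < z.1) by apply/idP/idP; lra.
  case: ifP => _; last by rewrite mulr0.
  rewrite (_ : 3 / 2 - (z.1 + 1) / 2 = 1 - z.1 / 2); last by field.
  by congr EFin; field.
- apply: measurable_funTS; apply: measurable_fun_ifT => //.
    exact: measurable_right_pt.
  apply: measurable_funM; first exact: measurable_snd.
  by apply: measurable_funX; apply: measurable_funB => //; exact: measurable_fst.
exists 1 => -[x y]; rewrite /unit_square /= !in_itv/= => -[/andP[x0 x1] /andP[y0 y1]].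
rewrite /pair_density /right_pt/=; case: ifP => x2; last by rewrite normr0.
rewrite normrM normrX mulr_ile1 ?exprn_ge0//; first by rewrite ger0_norm.
by rewrite exprn_ile1// ler_norml; lra.
Qed.

Lemma integral_id_itv (R : realType) (a b : R) : 0 <= a -> a < b ->
  (\int[lebesgue_measure]_(y in `]a, b[) y%:E = ((b ^+ 2 - a ^+ 2) / 2)%:E)%E.
Proof.
move=> a0 ab; transitivity (\int[lebesgue_measure]_(y in `[a, b]) y%:E)%E.
  by rewrite [RHS]integral_itv_bndoo.
pose F x : R := x ^+ 2 / 2.
have d (x : R) : is_derive x 1 F x.
  rewrite (_ : F = (2^-1 \*: (@id R ^+ 2))); last first.
    by apply/funext => y; rewrite /F !fctE [RHS]mulrC.
  by apply: is_derive_eq; rewrite /GRing.scale/=; field.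
have c (x : R) : F @ x --> F x.
  by apply: differentiable_continuous; apply/derivable1_diffP; exact: ex_derive.
rewrite (@continuous_FTC2 _ id F)//.
- by rewrite -EFinB /F; congr EFin; ring.
- by apply: continuous_subspaceT => x; exact: cvg_id.
- split; [|exact/cvg_at_right_filter/c|exact/cvg_at_left_filter/c].
  by move=> x _; exact: ex_derive.
- by move=> x _; rewrite derive1E; exact: derive_val.
Qed.

(** The integral of [y] is 1/8 over the lower half of the unit interval and 3/8 over the upper
    half. *)
Lemma integral_two_levels (R : realType) (a b : R) : 0 <= a -> 0 <= b ->
  (\int[lebesgue_measure]_y (y * (if 0 < y < 2^-1 then a
     else if 2^-1 < y < 1 then b else 0))%:E = (a / 8 + 3 * b / 8)%:E)%E.
Proof.
move=> a0 b0.
pose f (c l u y : R) := ((fun y => (c * y)%:E) \_ `]l, u[%classic) y.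
have fint c l u : 0 <= c -> 0 <= l -> l < u ->
    (\int[lebesgue_measure]_y f c l u y = (c * ((u ^+ 2 - l ^+ 2) / 2))%:E)%E.
  move=> c0 l0 lu; rewrite /f -integral_mkcond.
  under eq_integral do rewrite EFinM.
  rewrite ge0_integralZl// ?integral_id_itv//.
  by move=> y; rewrite /= in_itv/= lee_fin => /andP[/ltW ly _]; exact: le_trans ly.
have f0 c l u : 0 <= c -> 0 <= l -> forall y, (0 <= f c l u y)%E.
  move=> c0 l0 y; rewrite /f patchE; case: ifP => //; rewrite inE/= in_itv/= => /andP[ly _].
  by rewrite lee_fin mulr_ge0// ltW// (le_lt_trans l0).
have mf c l u : measurable_fun setT (f c l u).
  apply/(measurable_restrictT _ _).1 => //; apply/measurable_EFinP; apply: measurable_funTS.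
  exact: measurable_funM.
transitivity (\int[lebesgue_measure]_y (f a 0%R 2^-1%R y + f b 2^-1%R 1%R y))%E.
  apply: eq_integral => y _; rewrite /f !patchE.
  have -> : (y \in `]0, 2^-1[%classic) = (0 < y < 2^-1) by apply/idP/idP; rewrite inE/= in_itv.
  have -> : (y \in `]2^-1, 1[%classic) = (2^-1 < y < 1) by apply/idP/idP; rewrite inE/= in_itv.
  case: ifP => y1; first by rewrite [(2^-1 < y)]ltNge (ltW (andP y1).2)/= adde0 mulrC.
  by case: ifP => _; rewrite add0e ?mulr0// mulrC.
have h0 : 0 <= 2^-1 :> R by rewrite invr_ge0.
rewrite ge0_integralD//; [|by move=> y _; exact: f0|exact: mf|by move=> y _; exact: f0|exact: mf].
rewrite !fint ?invr_gt0//; last by rewrite invf_lt1 ?ltr1n.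
by rewrite -EFinD; congr EFin; field.
Qed.

Lemma density1_support (R : realType) (x y : R) :
  density1 (x, y) != 0 -> (0 < x < 1) && (0 < y < 1).
Proof.
rewrite /density1; do 4![case: ifP => [/andP[/andP[? ?] /andP[? ?]] _|_]; first by lra].
by rewrite eqxx.
Qed.

(* the conditional mean of [y] given [x] under the density [density1] *)
Definition first_moment (R : realType) (x : R) : R :=
  if x < 2^-1 then 1 / 2 - sin (ln x) / 4
  else if 2^-1 < x < 1 then 1 / 2 + dens_const R / 4 else 0.

Lemma density1_first_moment (R : realType) (x : R) :
  (\int[lebesgue_measure]_y (y * density1 (x, y))%:E =
   (if 0 < x then first_moment x else 0)%:E)%E.
Proof.
have := @sin_norm_le1 R (ln x); rewrite ler_norml => /andP[s1 s2].
have := @dens_const_norm R; rewrite ler_norml => /andP[c1 c2].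
have [x0|x0] := ltP 0 x; last first.
  apply: integral0_eq => y _.
  have [->|/density1_support] := eqVneq (density1 (x, y)) 0; first by rewrite mulr0.
  by rewrite ltNge x0.
rewrite /first_moment.
have [x2|x2] := ltP x 2^-1.
  transitivity (\int[lebesgue_measure]_y (y * (if 0 < y < 2^-1 then 1 + sin (ln x)
     else if 2^-1 < y < 1 then 1 - sin (ln x) else 0))%:E)%E.
    by apply: eq_integral => y _; rewrite /density1 x0 x2 /= (ltNge 2^-1 x) (ltW x2).
  by rewrite integral_two_levels; [congr EFin; field|lra|lra].
have nx2 : (x < 2^-1) = false by rewrite ltNge x2.
have [x1|x1] := boolP (2^-1 < x < 1).
  transitivity (\int[lebesgue_measure]_y (y * (if 0 < y < 2^-1 then 1 - dens_const R
     else if 2^-1 < y < 1 then 1 + dens_const R else 0))%:E)%E.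
    by apply: eq_integral => y _; rewrite /density1 x0 nx2 x1.
  by rewrite integral_two_levels; [congr EFin; field|lra|lra].
apply: integral0_eq => y _.
by rewrite /density1 x0 nx2 (negbTE x1) /= mulr0.
Qed.

Lemma norm_first_moment (R : realType) (x : R) : `|4 * first_moment x| <= 3.
Proof.
have := @sin_norm_le1 R (ln x); rewrite ler_norml => /andP[s1 s2].
have := @dens_const_norm R; rewrite ler_norml => /andP[c1 c2].
rewrite ler_norml /first_moment; case: ifP => _; first by lra.
by case: ifP => _; lra.
Qed.

Lemma measurable_first_moment (R : realType) : measurable_fun setT (@first_moment R).
Proof.
apply: measurable_fun_ifT; first exact: measurable_fun_ltr.
  apply: measurable_funB => //; apply: measurable_funM => //.
  exact: measurable_sin_ln.
by apply: measurable_fun_ifT => //; apply: measurable_and; exact: measurable_fun_ltr.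
Qed.

(** Integrating out [y] leaves [p] as the integral of [(1 - x/2)^m / 4 * first_moment x]. For
    [x < 1/2] the factor [4 * first_moment x] is [2 - sin (ln x)]; beyond 1/2 the weight is at most
    [(3/4)^m]. *)
Lemma integral_pair_density_asymp (R : realType)
    (mu1 mu2 : probability (R * R)%type R) (m : nat) :
  has_density mu1 (@density1 R) -> char2 mu1 mu2 ->
  exists p : R,
    (\int[mu2]_(z in @unit_square R) (pair_density m z)%:E)%E = p%:E /\
    `|16 * p - 2 * osc_int (fun=> 1) m + osc_int (@sin R) m| <= 6 * (3 / 4) ^+ m.
Proof.
move=> hd hc; rewrite (integral_pair_density m hc).
pose w (x : R) := (1 - x / 2) ^+ m.
have mw : measurable_fun setT w.
  by apply: measurable_funX; apply: measurable_funB => //; exact: measurable_funM.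
have w0 x : x <= 2 -> 0 <= w x by move=> x2; rewrite exprn_ge0//; lra.
have w1 x : 0 <= x <= 2 -> w x <= 1 by move=> x2; rewrite exprn_ile1//; lra.
have w34 x : 2^-1 <= x <= 2 -> w x <= (3 / 4) ^+ m.
  by move=> x2; rewrite lerXn2r ?nnegrE//; lra.
pose g (z : R * R) : R := if 0 < z.1 then 4^-1 * (z.2 * w z.1) else 0.
have mg : measurable_fun setT g.
  apply: measurable_fun_ifT => //.
    by apply: measurable_fun_ltr => //; exact: measurable_fst.
  apply: measurable_funM => //; apply: measurable_funM; first exact: measurable_snd.
  exact: (measurableT_comp mw measurable_fst).
have msq : measurable (@unit_square R) by exact: measurableX.
have mf := @measurable_density1 R.
pose leb2 : {sigma_finite_measure
    set (measurableTypeR R * measurableTypeR R)%type -> \bar R} :=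
  HB.pack (@lebesgue_measure R \x @lebesgue_measure R)%E
    (Measure_isSigmaFinite.Build _ _ _ _ (@lebesgue_square_sigma_finite R)).
(* [R * R] and [measurableTypeR R * measurableTypeR R] have the same measurable
   sets but distinct displays; [mu1] is carried over by the identity *)
have mid : measurable_fun setT
    (fun z : R * R => (z : (measurableTypeR R * measurableTypeR R)%type)).
  exact: (@measurable_id _ (R * R)%type setT).
pose mid' : {mfun (R * R)%type >-> (measurableTypeR R * measurableTypeR R)%type} :=
  HB.pack (fun z : R * R => (z : (measurableTypeR R * measurableTypeR R)%type))
    (isMeasurableFun.Build _ _ _ _ _ mid).
have g0 z : unit_square z -> 0 <= g z.
  case: z => x y; rewrite /unit_square /= !in_itv/= => -[/andP[x0 x1] /andP[y0 y1]].
  by rewrite /g/=; case: ifP => // _; rewrite !mulr_ge0// w0//; lra.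
have -> : (\int[mu1]_(z in @unit_square R) (g z)%:E =
    \int[distribution mu1 mid']_(z in @unit_square R) (g z)%:E)%E.
  rewrite [RHS]ge0_integral_pushforward//.
  - by apply/measurable_EFinP; exact: measurable_funTS.
  - by move=> z /set_mem /g0; rewrite lee_fin.
rewrite (@integral_density R _ _ leb2 (distribution mu1 mid') (@density1 R) g)//; last 2 first.
- by move=> z; exact: density1_ge0.
- apply: (@bounded_integrable _ _ _ _ _ _ 1) => //.
    by rewrite (le_lt_trans (probability_le1 _ _)) ?ltry.
  move=> [x y]; rewrite /unit_square /= !in_itv/= => -[/andP[x0 x1] /andP[y0 y1]].
  rewrite /g/=; case: ifP => _; last by rewrite normr0.
  have h0 := w0 x (ltac:(lra)); have h1 := w1 x (ltac:(lra)).
  by rewrite ger0_norm ?mulr_ge0//; nra.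
pose Phi (x : R) := w x / 4 * first_moment x.
have mPhi : measurable_fun setT Phi.
  by apply: measurable_funM; [exact: measurable_funM|exact: measurable_first_moment].
(* The density vanishes off the unit square, so the weight may be cut off to [0 < x <= 2], where it
   is nonnegative as the Tonelli argument requires. *)
have gE (x y : R) : g (x, y) * density1 (x, y) =
    (if 0 < x <= 2 then w x / 4 else 0) * (y * density1 (x, y)).
  have [->|/density1_support/andP[/andP[x0 x1] _]] := eqVneq (density1 (x, y)) 0.
    by rewrite !mulr0.
  by rewrite /g/= x0 (le_trans (ltW x1)) ?ler1n//=; ring.
have sgn (x : R) : 0 <= (if 0 < x <= 2 then w x / 4 else 0).
  by case: ifP => // /andP[_ x2]; rewrite divr_ge0// w0.
have ydens (x y : R) : 0 <= y * density1 (x, y).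
  have [->|/density1_support/andP[_ /andP[y0 _]]] := eqVneq (density1 (x, y)) 0.
    by rewrite mulr0.
  by rewrite mulr_ge0 ?density1_ge0// ltW.
have PhiE (x : R) : (\int[lebesgue_measure]_y (g (x, y) * density1 (x, y))%:E)%E =
    (if 0 < x <= 2 then Phi x else 0)%:E.
  under eq_integral do rewrite gE EFinM.
  rewrite ge0_integralZl//; last 3 first.
  - apply/measurable_EFinP; apply: measurable_funM => //.
    exact: (measurable_fun_pair2 x mf).
  - by move=> y _; rewrite lee_fin; exact: ydens.
  - by rewrite lee_fin; exact: sgn.
  rewrite density1_first_moment -EFinM; congr EFin.
  by rewrite /Phi; case: (0 < x); rewrite /= ?mul0r//; case: ifP; rewrite ?mul0r.
have G0 z : 0 <= g z * density1 z.
  by case: z => x y; rewrite gE mulr_ge0.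
have -> : (\int[leb2]_(z in @unit_square R) (g z * density1 z)%:E =
    \int[lebesgue_measure]_(x in `[0%R, 2%R]) (Phi x)%:E)%E.
  transitivity (\int[leb2]_z (g z * density1 z)%:E)%E.
    rewrite integral_mkcond; apply: eq_integral => -[x y] _; rewrite patchE.
    case: ifPn => //; rewrite notin_setE => xy.
    have [->|/density1_support/andP[/andP[x0 x1] /andP[y0 y1]]] :=
        eqVneq (density1 (x, y)) 0; first by rewrite mulr0.
    by case: xy; rewrite /unit_square/= !in_itv/= !ltW.
  rewrite fubini_tonelli1//; last first.
    by apply/measurable_EFinP; exact: measurable_funM.
  rewrite /fubini_F; under eq_integral do rewrite PhiE.
  transitivity (\int[lebesgue_measure]_(x in `]0%R, 2%R]) (Phi x)%:E)%E.
    rewrite [RHS]integral_mkcond; apply: eq_integral => x _; rewrite patchE.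
    have -> : (x \in `]0, 2]%classic) = (0 < x <= 2) by apply/idP/idP; rewrite inE/= in_itv.
    by case: ifP.
  by rewrite integral_itv_obnd_cbnd//; apply/measurable_EFinP; exact: measurable_funTS.
have iPhi : lebesgue_measure.-integrable `[0, 2] (EFin \o Phi).
  apply: (@bounded_integrable _ _ _ _ _ _ 1) => //; first exact: lebesgue_itv_fin.
  move=> x; rewrite /= in_itv/= => x02.
  have := norm_first_moment x; have := w1 x x02; have := w0 x (andP x02).2.
  rewrite /Phi !ler_norml => *; apply/andP; split; nra.
have iw (q : R -> R) : continuous q -> (forall x : R, `|q x| <= 1) ->
    lebesgue_measure.-integrable `[0, 2] (EFin \o (fun x => w x * q (ln x))).
  exact: osc_integrable.
have i1 : lebesgue_measure.-integrable `[0, 2] (EFin \o (fun x => w x * 1)).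
  by apply: (iw (fun=> 1)) => x; [exact: cvg_cst|rewrite normr1].
have is_ := iw (@sin R) (@continuous_sin R) (@sin_norm_le1 R).
exists (\int[lebesgue_measure]_(x in `[0, 2]) Phi x); split.
  by rewrite /Rintegral fineK// integrable_fin_num.
(* This integrand is zero for [x < 1/2] and at most [3 * (3/4)^m] in absolute value on the rest of
   [[0, 2]], whence the constant 6. *)
pose e (x : R) := 16 * Phi x - 2 * (w x * 1) + w x * sin (ln x).
have -> : 16 * \int[lebesgue_measure]_(x in `[0, 2]) Phi x - 2 * osc_int (fun=> 1) m + osc_int (@sin R) m
    = \int[lebesgue_measure]_(x in `[0, 2]) e x.
  have i16 : lebesgue_measure.-integrable `[0, 2] (EFin \o (fun x => 16 * Phi x)).
    exact: (integrableZl _ _ iPhi).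
  have i2 : lebesgue_measure.-integrable `[0, 2] (EFin \o (fun x => 2 * (w x * 1))).
    exact: (integrableZl _ _ i1).
  by rewrite /e RintegralD//; [rewrite RintegralB// !RintegralZl|exact: (integrableB _ i16 i2)].
have -> : 6 * (3 / 4) ^+ m = 3 * (3 / 4) ^+ m * (2 - 0) :> R by ring.
apply: norm_Rintegral_le => //.
  apply: measurable_funD; first apply: measurable_funB.
  - exact: measurable_funM.
  - by apply: measurable_funM => //; exact: measurable_funM.
  - by apply: measurable_funM => //; exact: measurable_sin_ln.
move=> x x02.
have eE : e x = w x * (4 * first_moment x - 2 + sin (ln x)) by rewrite /e /Phi; field.
have [x2|x2] := ltP x 2^-1.
  rewrite eE /first_moment x2 (_ : _ - 2 + _ = 0) ?mulr0 ?normr0 ?mulr_ge0 ?exprn_ge0//.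
  by field.
have h34 : w x <= (3 / 4) ^+ m by apply: w34; lra.
rewrite eE normrM mulrC (ger0_norm (w0 _ (andP x02).2)) ler_pM ?w0 ?(andP x02).2//.
have := @sin_norm_le1 R (ln x); rewrite ler_norml => /andP[s1 s2].
have := @dens_const_norm R; rewrite ler_norml => /andP[c1 c2].
rewrite ler_norml /first_moment ltNge x2 /=.
by case: ifP => _; lra.
Qed.

(* the integral of a nonnegative function is a supremum over the simple
   functions below it *)
Lemma ge0_le_integral_nonmeasurable (R : realType) d (T : measurableType d)
    (mu : {measure set T -> \bar R}) (f g : T -> \bar R) :
  (forall x, 0 <= f x)%E -> (forall x, f x <= g x)%E ->
  (\int[mu]_x f x <= \int[mu]_x g x)%E.
Proof.
move=> f0 fg; rewrite !ge0_integralTE//; last first.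
  by move=> x; exact: le_trans (fg x).
by apply: le_ereal_sup => _ [h hf <-]; exists h => // x; exact: le_trans (fg x).
Qed.

Lemma integral_sum_indic (R : realType) d (T : measurableType d)
    (P : probability T R) (I : finType) (Q : pred I) (A : I -> set T) :
  (forall i, measurable (A i)) ->
  (\int[P]_x (\sum_(i | Q i) \1_(A i) x)%:E = \sum_(i | Q i) P (A i))%E.
Proof.
move=> mA; rewrite -big_filter; under eq_integral do rewrite -sumEFin -big_filter.
rewrite ge0_integral_sum//; last by move=> i; exact/measurable_EFinP/measurable_indic.
by apply: eq_bigr => i _; rewrite integral_indic// setIT.
Qed.

(** * Almost sure position of the sample points *)

Lemma measurable_typical_pt (R : realType) : measurable_fun setT (@typical_pt R).
Proof.
have m1 : measurable_fun setT (fun p : R * R => p.1) by exact: measurable_fst.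
have m2 : measurable_fun setT (fun p : R * R => p.2) by exact: measurable_snd.
rewrite /typical_pt; do 3?[apply: measurable_and; first exact: measurable_fun_ler].
apply: measurable_fun_ifT; first exact: measurable_fun_ltr.
  exact: measurable_fun_ler.
apply: measurable_and; first exact: measurable_fun_ltr.
by apply: measurable_fun_eqr => //; exact: measurable_funD.
Qed.

(** The characterization of [mu2] is applied to the indicator of the atypical points; it vanishes on
    both image pieces up to null sets. *)
Lemma almost_surely_typical (R : realType) (mu1 mu2 : probability (R * R)%type R) :
  permuton mu1 -> permuton mu2 -> char2 mu1 mu2 ->
  mu2 [set p | ~~ typical_pt p] = 0%E.
Proof.
move=> h1 h2 hc; set N := [set p | _].
have mN : measurable N.
  by apply: measurable_bool_set; apply: measurable_neg; exact: measurable_typical_pt.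
have mN1 : measurable_fun setT (\1_N : R * R -> R) by exact: measurable_indic.
have msq : measurable (@unit_square R) by exact: measurableX.
have sqE z : unit_square z <-> in_square z.
  rewrite /unit_square /= !in_itv/= /in_square; split.
    by case=> /andP[-> ->] /andP[-> ->].
  by case/and4P => -> -> -> ->.
apply/eqP; rewrite eq_le measure_ge0 andbT.
have -> : mu2 N = mu2 (N `&` @unit_square R).
  rewrite -(setIT N) -{1}(setvU (@unit_square R)) setIUr.
  rewrite measureU ?[X in (X + _)%E](_ : _ = 0%E) ?add0e ?setIT//.
  - apply/eqP; rewrite eq_le measure_ge0 andbT.
    have <- : mu2 (~` @unit_square R) = 0%E.
      by rewrite probability_setC//; case: h2 => -> _ _; rewrite subee.
    by apply: le_measure; rewrite ?inE//; [apply: measurableI => //|]; exact: measurableC.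
  - by apply: measurableI => //; exact: measurableC.
  - exact: measurableI.
  - by rewrite setIACA setICl setI0.
have -> : mu2 (N `&` @unit_square R) =
    (\int[mu2]_(z in @unit_square R) (\1_N z)%:E)%E by rewrite integral_indic.
rewrite hc; last 2 first.
- by apply: measurable_funTS; exact: measurable_indic.
- by exists 1 => z _; rewrite indicE ger0_norm// lern1 leq_b1.
rewrite [X in (X + _)%E](_ : _ = 0%E) ?add0e; last first.
  (* On the diagonal piece only [t = 0] is atypical. *)
  rewrite -integral_itv_obnd_cbnd.
    apply: integral0_eq => t; rewrite /= in_itv/= => /andP[t0 t2].
    rewrite indicE; case: (boolP (_ \in N)) => //; rewrite inE /N/= /typical_pt/=.
    rewrite (ltNge 2^-1 t) t2 /= t0 eqxx /= andbT.
    by move=> /negP[]; apply/and3P; split; lra.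
  apply/measurable_EFinP; apply: measurable_funTS.
  have mp : measurable_fun setT (fun t : R => (t, 2^-1 + t)).
    by apply: measurable_fun_pair => //; exact: measurable_funD.
  exact: (measurableT_comp mN1 mp).
(* Points with [x = 0] land on the line of abscissa 1/2, which counts as left half; that line of
   departure is null for [mu1]. *)
rewrite (@ge0_negligible_integral _ _ _ mu1 _ [set p | p.1 == 0])//.
- rewrite integral0_eq// => -[x y] [/sqE/and4P[/= x0 x1 y0 y1]] /= xn0.
  rewrite indicE; case: (boolP (_ \in N)) => [|_]; last by rewrite mulr0.
  rewrite inE /N/= /typical_pt/=.
  have xp : 0 < x by rewrite lt_neqAle x0 andbT eq_sym; exact/negP.
  rewrite (_ : 2^-1 < (x + 1) / 2); last by lra.
  by move=> /negP[]; apply/and4P; split; lra.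
- by apply: measurable_bool_set; apply: measurable_fun_eqr => //; exact: measurable_fst.
- apply/measurable_EFinP; apply: measurable_funTS; apply: measurable_funM => //.
  have mp : measurable_fun setT (fun z : R * R => ((z.1 + 1) / 2, z.2 / 2)).
    apply: measurable_fun_pair; apply: measurable_funM => //.
    by apply: measurable_funD => //; exact: measurable_fst.
  exact: (measurableT_comp mN1 mp).
- exact: permuton_vertical_line.
Qed.

(** Given [Z j], the other point would have to fall on a fixed vertical line, a null set by
    uniformity of the marginal. *)
Lemma no_common_abscissa (R : realType) (mu : probability (R * R)%type R)
    d (Om : measurableType d) (P : probability Om R) n
    (Z : 'I_n -> {RV P >-> (R * R)%type}) (i j : 'I_n) :
  permuton mu -> iid_points mu Z -> i != j ->
  P [set w | (Z i w).1 == (Z j w).1] = 0%E.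
Proof.
move=> hmu iid ij.
have mE : measurable [set u : (R * R) * (R * R) | u.2.1 == u.1.1].
  apply: measurable_bool_set; apply: measurable_fun_eqr.
    exact: measurableT_comp measurable_fst measurable_snd.
  exact: measurableT_comp measurable_fst measurable_fst.
rewrite (@indep_section _ _ _ P _ _ _ _ mu (Z j) (Z i) [set u | u.2.1 == u.1.1])//.
  apply: integral0_eq => z _.
  rewrite (_ : _ @^-1` _ = Z i @^-1` [set p | p.1 == z.1]); last first.
    by apply/seteqP; split => w /=; rewrite /xsection/= inE.
  rewrite -(permuton_vertical_line hmu z.1) -(iid.1 i)//.
  by apply: measurable_bool_set; apply: measurable_fun_eqr => //; exact: measurable_fst.
move=> A B mA mB.
have := iid_rect iid ij mA mB measurableT.
rewrite probability_setT expr1n mule1 -[mu B](iid.1 i)// => <-.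
by congr (P _); apply/seteqP; split => w /=; [case|case].
Qed.

Lemma prob_all_in (R : realType) (mu : probability (R * R)%type R)
    d (Om : measurableType d) (P : probability Om R) n
    (Z : 'I_n -> {RV P >-> (R * R)%type}) (A : set (R * R)) (q : R) :
  iid_points mu Z -> measurable A -> mu A = q%:E ->
  P [set w | forall i, A (Z i w)] = (q ^+ n)%:E.
Proof.
move=> iid mA muA; rewrite (iid.2 (fun=> A))//.
rewrite (eq_bigr (fun=> q%:E)) => [|i _]; last by rewrite -muA -(iid.1 i).
by rewrite prodEFin prodr_const card_ord.
Qed.

(** * The expected size of the subtree at 00 *)

Lemma integral_affine (R : realType) d (T : measurableType d)
    (P : probability T R) (f g : T -> R) (a b c : R) :
  measurable_fun setT f -> measurable_fun setT g ->
  (forall x, 0 <= f x) -> (forall x, 0 <= g x) -> 0 <= a -> 0 <= b -> 0 <= c ->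
  (\int[P]_x (a * f x + b * g x + c)%:E =
   a%:E * \int[P]_x (f x)%:E + b%:E * \int[P]_x (g x)%:E + c%:E)%E.
Proof.
move=> mf mg f0 g0 a0 b0 c0.
have maf : measurable_fun setT (fun x => (a * f x)%:E).
  by apply/measurable_EFinP; exact: measurable_funM.
have mbg : measurable_fun setT (fun x => (b * g x)%:E).
  by apply/measurable_EFinP; exact: measurable_funM.
under eq_integral do rewrite !EFinD.
rewrite ge0_integralD//=; last 2 first.
- by move=> x _; rewrite -EFinD lee_fin addr_ge0// mulr_ge0.
- exact: emeasurable_funD.
rewrite ge0_integralD//=; last 2 first.
- by move=> x _; rewrite lee_fin mulr_ge0.
- by move=> x _; rewrite lee_fin mulr_ge0.
rewrite integral_cst//= probability_setT mule1.
under eq_integral do rewrite EFinM.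
rewrite ge0_integralZl//; last 2 first.
- exact/measurable_EFinP.
- by move=> x _; rewrite lee_fin.
congr (_ + _ + _)%E.
under eq_integral do rewrite EFinM.
rewrite ge0_integralZl//; last by move=> x _; rewrite lee_fin.
exact/measurable_EFinP.
Qed.

Section expected_subtree_size.
Context (R : realType) (mu1 mu2 : probability (R * R)%type R)
  (hmu1 : permuton mu1) (hmu2 : permuton mu2) (hchar : char2 mu1 mu2)
  d (Om : measurableType d) (P : probability Om R) (n : nat) (n0 : (0 < n)%N)
  (Z : 'I_n -> {RV P >-> (R * R)%type}) (iid : iid_points mu2 Z).

Let t w : R := subtree_frac R (bst_points [seq Z i w | i <- enum 'I_n])
  [:: false; false].

Let c w := count (prefix [:: false; false])
      (nodes (bst_points [seq Z i w | i <- enum 'I_n])).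

Let size_tree w : size (nodes (bst_points [seq Z i w | i <- enum 'I_n])) = n.
Proof. by rewrite /bst_points size_nodes_bst size_map size_sort size_map size_enum_ord. Qed.

Let N : R := n%:R.

Let tE w : t w = (c w)%:R / N.
Proof. by rewrite /t /subtree_frac size_tree. Qed.

Let N0 : 0 < N. Proof. by rewrite ltr0n. Qed.
Let N1 : 1 <= N. Proof. by rewrite ler1n. Qed.

Let t01 w : 0 <= t w <= 1.
Proof.
rewrite tE divr_ge0 ?(ltW N0)//= ler_pdivrMr// mul1r ler_nat.
by rewrite -[leqRHS](size_tree w) count_size.
Qed.

(** Indexes the exceptional events: an atypical point, a common abscissa, or all points in the same
    half. Below, [b] counts those that occur; only the last kind has positive probability, [2^-n]
    for each half. *)
Let K : finType := ('I_n + 'I_n * 'I_n + bool)%type.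

Let Q (k : K) : bool := if k is inl (inr ij) then ij.1 != ij.2 else true.

Let A (k : K) : set Om :=
  match k with
  | inl (inl i) => [set w | ~~ typical_pt (Z i w)]
  | inl (inr ij) => [set w | (Z ij.1 w).1 == (Z ij.2 w).1]
  | inr true => [set w | forall i, [set p | right_pt p] (Z i w)]
  | inr false => [set w | forall i, [set p | ~~ right_pt p] (Z i w)]
  end.

Let mr : measurable [set p : R * R | right_pt p].
Proof. by apply: measurable_bool_set; exact: measurable_right_pt. Qed.

Let ml : measurable [set p : R * R | ~~ right_pt p].
Proof. by apply: measurable_bool_set; apply: measurable_neg; exact: measurable_right_pt. Qed.

Let mall (B : set (R * R)) : measurable B ->
  measurable [set w | forall i, B (Z i w)].
Proof.
move=> mB.
rewrite (_ : [set w | _] = \bigcap_(i in [set: 'I_n]) Z i @^-1` B); last first.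
  by apply/seteqP; split => w /= h i => [_|]; exact: h.
by apply: fin_bigcap_measurable => // i _; exact: measurable_funPTI.
Qed.

Let mA k : measurable (A k).
Proof.
case: k => [[i|[i j]]|[]] /=; [| |exact: (mall mr)|exact: (mall ml)].
  rewrite (_ : [set w | _] = Z i @^-1` [set p | ~~ typical_pt p])//.
  apply: measurable_funPTI => //.
  by apply: measurable_bool_set; apply: measurable_neg; exact: measurable_typical_pt.
apply: measurable_bool_set; apply: measurable_fun_eqr.
  exact: (measurableT_comp measurable_fst).
exact: (measurableT_comp measurable_fst).
Qed.

Let b w : R := \sum_(k | Q k) \1_(A k) w.

Let intb : (\int[P]_w (b w)%:E = (2 * 2^-1 ^+ n)%:E)%E.
Proof.
rewrite integral_sum_indic// big_sumType /= big_sumType /= big_bool /=.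
rewrite big1 ?add0e => [|i _]; last first.
  rewrite -(almost_surely_typical hmu1 hmu2 hchar) -(iid.1 i)//.
  by apply: measurable_bool_set; apply: measurable_neg; exact: measurable_typical_pt.
rewrite big1 ?add0e => [|[i j] /= ij]; last exact: (no_common_abscissa hmu2 iid).
rewrite (prob_all_in iid mr (permuton_right hmu2)).
by rewrite (prob_all_in iid ml (permuton_left hmu2)) -EFinD -mulr2n mulr_natl.
Qed.

Let E i j := [set w | @pair_event R (Z j w, (Z i w, right_min (fun k => Z k w) i j))].

Let mE i j : measurable (E i j).
Proof.
have mm : measurable_fun setT
    (fun w => (Z j w, (Z i w, right_min (fun k => Z k w) i j))).
  apply: measurable_fun_pair => //; apply: measurable_fun_pair => //.
  exact: measurable_right_min.
have := mm measurableT _ (@measurable_pair_event R); rewrite setTI; exact.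
Qed.

(** The number of leading pairs, with [u] read as [(j, i)]. Its mean is [n * (n - 1)] times the
    probability of one pair. *)
Let H w : R := \sum_(u : 'I_n * 'I_n | u.2 != u.1) \1_(E u.2 u.1) w.

Let intH (p : R) :
  (\int[mu2]_(z in @unit_square R) (pair_density n.-2 z)%:E)%E = p%:E ->
  (\int[P]_w (H w)%:E = (N * (n.-1%:R * p))%:E)%E.
Proof.
move=> pE; rewrite (integral_sum_indic P (fun u => u.2 != u.1) (fun u => mE u.2 u.1)).
rewrite (eq_bigr (fun=> p%:E)); last first.
  by move=> [j i] /= ij; rewrite -pE (prob_pair_eventE hmu2 iid ij).
rewrite sumEFin; congr EFin.
rewrite -(pair_big_dep xpredT (fun j i : 'I_n => i != j) (fun _ _ => p))/=.
rewrite (eq_bigr (fun=> p *+ n.-1)); last first.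
  by move=> j _; rewrite sumr_const cardC1 card_ord.
by rewrite sumr_const card_ord -[_ *+ n]mulr_natl -[p *+ _]mulr_natl.
Qed.

Let b0 w : 0 <= b w. Proof. by apply: sumr_ge0 => k _; rewrite indicE. Qed.
Let H0 w : 0 <= H w. Proof. by apply: sumr_ge0 => k _; rewrite indicE. Qed.

Let Hle w : H w <= N ^+ 2.
Proof.
apply: (@le_trans _ _ (\sum_(u : 'I_n * 'I_n) 1)).
  rewrite [leRHS](bigID (fun u : 'I_n * 'I_n => u.2 != u.1))/= -[H w]addr0.
  apply: lerD; last by apply: sumr_ge0.
  by apply: ler_sum => u _; rewrite indicE lern1 leq_b1.
by rewrite sumr_const card_prod card_ord -natrX.
Qed.

Let sandwich w : (c w)%:R <= H w <= (c w).+1%:R \/ 1 <= b w.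
Proof.
have [[k Qk Akw]|good] := pselect (exists2 k, Q k & A k w); [right|left].
  rewrite /b (bigD1 k)//= indicE mem_set// lerDl.
  by apply: sumr_ge0 => k' _; rewrite indicE.
have typ i : typical_pt (Z i w).
  by apply/negPn/negP => h; apply: good; exists (inl (inl i)).
have inj : injective (fst \o (fun i => Z i w)).
  move=> i j /= ij; apply/eqP/negPn/negP => nij.
  by apply: good; exists (inl (inr (i, j))) => //=; apply/eqP.
have hasr : exists i, right_pt (Z i w).
  apply: contrapT => h; apply: good; exists (inr false) => //= i.
  by apply/negP => ri; apply: h; exists i.
have hasl : exists i, ~~ right_pt (Z i w).
  apply: contrapT => h; apply: good; exists (inr true) => //= i.
  by apply/negPn/negP => ri; apply: h; exists i.
have := count_left_left_pairs typ inj hasr hasl; rewrite -/(c w).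
(* Off the exceptional events the two notions of leading pair coincide: right points have abscissa
   at most 1, so the default 2 never decides a comparison. *)
suff -> : H w = (\sum_(j < n) \sum_(i < n | i != j)
    leading_above (fun k => Z k w) i j)%N%:R by rewrite !ler_nat.
rewrite /H -(pair_big_dep xpredT (fun j i : 'I_n => i != j) (fun j i => \1_(E i j) w))/=.
rewrite natr_sum; apply: eq_bigr => j _; rewrite natr_sum; apply: eq_bigr => i _.
rewrite indicE; congr (nat_of_bool _)%:R.
have sq : right_pt (Z j w) -> in_square (Z j w).
  move=> rj; have := typ j; rewrite /typical_pt -/(right_pt _) rj /in_square.
  by case/and4P => -> -> -> y2 /=; lra.
rewrite /leading_above; apply/idP/idP.
  rewrite inE /E /pair_event /= => /and4P[rj _ -> /bigmin_geP[_ h]].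
  rewrite rj /=; apply/forallP => k; apply/implyP => /h.
  by rewrite /right_coord; case: ifP.
move=> /and3P[rj ij /forallP h]; rewrite inE /E /pair_event /= rj sq// ij /=.
apply/bigmin_geP; split; first by have /and4P[_ x1 _ _] := sq rj; lra.
move=> k kij; have /implyP/(_ kij) := h k; rewrite /right_coord.
by case: ifP => //= _ _; have /and4P[_ x1 _ _] := sq rj; lra.
Qed.

Let mb : measurable_fun setT b.
Proof.
rewrite (_ : b = fun w => \sum_(k <- [seq k <- index_enum K | Q k]) \1_(A k) w).
  by apply: measurable_sum => k; exact: measurable_indic.
by apply/funext => w; rewrite /b big_filter.
Qed.

Let mH : measurable_fun setT H.
Proof.
rewrite (_ : H = fun w => \sum_(u <- [seq u : 'I_n * 'I_n <- index_enum _ |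
    u.2 != u.1]) \1_(E u.2 u.1) w).
  by apply: measurable_sum => k; exact: measurable_indic.
by apply/funext => w; rewrite /H big_filter.
Qed.

(** The integral of [t] is squeezed by monotonicity between those of measurable functions:
    [H / N + b] above and [L] below. *)
Lemma expected_subtree_frac (p : R) :
  (\int[mu2]_(z in @unit_square R) (pair_density n.-2 z)%:E)%E = p%:E ->
  exists e : R, (\int[P]_w (t w)%:E)%E = e%:E /\
    `|e - n.-1%:R * p| <= N^-1 + N * (2 * 2^-1 ^+ n).
Proof.
move=> pE; have HE := intH pE.
have t0 w : (0 <= (t w)%:E)%E by rewrite lee_fin; case/andP: (t01 w).
have tup w : t w <= N^-1 * H w + 1 * b w + 0.
  rewrite mul1r addr0; case: (sandwich w) => [/andP[ch _]|b1].
    by rewrite tE mulrC -[leLHS]addr0 lerD// ler_pM2l ?invr_gt0.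
  by rewrite -[leLHS]add0r lerD ?mulr_ge0 ?invr_ge0 ?(ltW N0)// (le_trans _ b1)//;
    case/andP: (t01 w).
(* Without exceptional event [H <= c + 1] gives the bound; otherwise [b >= 1] and [H <= N^2] make
   the second argument nonpositive. *)
pose L w := Num.max 0 (N^-1 * (H w - 1) - N * b w).
have mL : measurable_fun setT L.
  apply: measurable_maxr => //; apply: measurable_funB; last exact: measurable_funM.
  by apply: measurable_funM => //; exact: measurable_funB.
have L0 w : 0 <= L w by rewrite le_max lexx.
have Lt w : L w <= t w.
  have /andP[tw0 tw1] := t01 w; rewrite ge_max tw0 /=.
  case: (sandwich w) => [/andP[_ ch]|b1].
    rewrite tE [_ / N]mulrC lerBlDr -[leLHS]addr0 lerD ?mulr_ge0 ?(ltW N0)//.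
    by rewrite ler_pM2l ?invr_gt0// lerBlDr natr1.
  apply: le_trans tw0; rewrite subr_le0; apply: (@le_trans _ _ N).
    by rewrite mulrC ler_pdivrMr// -expr2 lerBlDr (le_trans (Hle w))// lerDl.
  by rewrite ler_peMr// ltW.
(* The lower bound is solved for [H], so that only nonnegative functions and coefficients are
   integrated. *)
have HL w : H w <= N * L w + N ^+ 2 * b w + 1.
  have : N^-1 * (H w - 1) - N * b w <= L w by rewrite le_max lexx orbT.
  rewrite lerBlDr mulrC ler_pdivrMr// lerBlDr => /le_trans; apply.
  by rewrite lerD2r mulrDl [_ * N]mulrC lerD2l mulrAC expr2.
have [e eE] : exists e, (\int[P]_w (t w)%:E)%E = e%:E.
  exists (fine (\int[P]_w (t w)%:E)%E); rewrite fineK// ge0_fin_numE.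
    apply: (@le_lt_trans _ _ (\int[P]_w (cst 1%E w))%E).
      by apply: ge0_le_integral_nonmeasurable => // w; rewrite lee_fin; case/andP: (t01 w).
    by rewrite integral_cst//= mul1e probability_setT ltry.
  by apply: integral_ge0 => w _.
exists e; split => //.
have eup : e <= n.-1%:R * p + 2 * 2^-1 ^+ n.
  rewrite -lee_fin -eE.
  apply: (@le_trans _ _ (\int[P]_w (N^-1 * H w + 1 * b w + 0)%:E)%E).
    by apply: ge0_le_integral_nonmeasurable => // w; rewrite lee_fin.
  rewrite integral_affine// ?invr_ge0 ?(ltW N0)// HE intb -!EFinM -!EFinD lee_fin.
  by rewrite mul1r addr0 mulKf ?lt0r_neq0.
have [l lE] : exists l, (\int[P]_w (L w)%:E)%E = l%:E /\ l <= e.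
  have le : (\int[P]_w (L w)%:E <= e%:E)%E.
    by rewrite -eE; apply: ge0_le_integral_nonmeasurable => w; rewrite lee_fin.
  have fi : (\int[P]_w (L w)%:E)%E \is a fin_num.
    rewrite ge0_fin_numE ?(le_lt_trans le) ?ltry//.
    by apply: integral_ge0 => w _; rewrite lee_fin.
  exists (fine (\int[P]_w (L w)%:E)%E); rewrite fineK//; split => //.
  by rewrite -lee_fin fineK.
case: lE => lE le.
have : N * (n.-1%:R * p) <= N * l + N ^+ 2 * (2 * 2^-1 ^+ n) + 1.
  rewrite -lee_fin -HE.
  apply: (@le_trans _ _ (\int[P]_w (N * L w + N ^+ 2 * b w + 1)%:E)%E).
    by apply: ge0_le_integral_nonmeasurable => w; rewrite lee_fin.
  by rewrite integral_affine// ?exprn_ge0 ?(ltW N0)// lE intb.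
set B := 2 * _ in eup *; set a := _ * p in eup * => elow.
have B0 : 0 <= B by rewrite mulr_ge0// exprn_ge0// invr_ge0.
have NB : B <= N * B by rewrite ler_peMl.
have {}elow : a <= l + N * B + N^-1.
  rewrite -(ler_pM2l N0) (le_trans elow)// !mulrDr divff ?lt0r_neq0//.
  by rewrite [N * (N * B)]mulrA -expr2.
have := invr_ge0 N; rewrite (ltW N0) => Ni.
by rewrite ler_norml; lra.
Qed.

End expected_subtree_size.

(** * Non-convergence *)

(** With [p = 1] the derivative term drops out of the integration by parts, so the sequence keeps
    its value at rank 0. *)
Lemma osc_int_cst1 (R : realType) n : n.+1%:R * osc_int (fun=> 1) n = 2 :> R.
Proof.
have h1 (x : R) : `|1 : R| <= 1 by rewrite normr1.
have h0 (x : R) : `|0 : R| <= 1 by rewrite normr0.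
have o0 m : osc_int (fun=> 0) m = 0 :> R.
  rewrite /osc_int; under eq_Rintegral do rewrite mulr0.
  by rewrite /Rintegral integral0.
have parts m : m.+1%:R * osc_int (fun=> 1) m - m%:R * osc_int (fun=> 1) m.-1
    = 2 * (1 - 2 / 2) ^+ m :> R.
  rewrite -[RHS]mulr1 -(@osc_int_parts R (fun=> 1) (fun=> 0)) ?o0 ?addr0//.
  by move=> x; exact: cvg_cst.
elim: n => [|n IH].
  by have := parts 0%N; rewrite expr0 mul0r subr0 mulr1.
by have := parts n.+1; rewrite divff// subrr expr0n mulr0 /= IH => /subr0_eq.
Qed.

(** As [3/4 <= (7/8)^2], one factor [(7/8)^n] absorbs [n + 1] and the other remains. *)
Lemma linear_times_geometric (R : realType) (n : nat) :
  n.+1%:R * (3 / 4) ^+ n <= 9 * (7 / 8) ^+ n :> R.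
Proof.
have h m : m%:R * (7 / 8) ^+ m <= 8 :> R.
  elim: m => [|m IH]; first by rewrite mul0r.
  have q1 : (7 / 8) ^+ m <= 1 :> R by apply: exprn_ile1; lra.
  by rewrite -natr1 exprS; nra.
have q0 : 0 <= (7 / 8) ^+ n :> R by rewrite exprn_ge0//; lra.
have q1 : (7 / 8) ^+ n <= 1 :> R by rewrite exprn_ile1//; lra.
apply: (@le_trans _ _ (n.+1%:R * ((7 / 8) ^+ n * (7 / 8) ^+ n))).
  by rewrite ler_pM2l// -exprMn lerXn2r ?nnegrE//; lra.
rewrite mulrA ler_wpM2r// -natr1 mulrDl mul1r.
by have := h n; lra.
Qed.

Theorem proposition5p4 (R : realType)
    (mu1 mu2 : probability (R * R)%type R)
    (hmu1 : permuton mu1) (hdens : has_density mu1 (@density1 R))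
    (hmu2 : permuton mu2) (hchar : char2 mu1 mu2)
    (d : nat -> measure_display) (Omega : forall n, measurableType (d n))
    (P : forall n, probability (Omega n) R)
    (Z : forall n, 'I_n -> {RV (P n) >-> (R * R)%type})
    (hZ : forall n, iid_points mu2 (Z n)) :
  ~ subtree_size_cvg P (fun n w => bst_points [seq Z n i w | i <- enum 'I_n]).
Proof.
(* The test function is the evaluation at 00, continuous for the product topology. *)
move=> [d' [Om' [P' [psi [psi01 _ /(_ (fun x => x [:: false; false]))]]]]].
set E := fun n : nat => _; move=> cvgE.
have {cvgE} : E n @[n --> \oo] --> 'E_P'[fun w => psi [:: false; false] w]%E.
  apply: cvgE; apply: continuous_subspaceT.
  exact: (@proj_continuous (seq bool) (fun=> R) [:: false; false]).
have : 'E_P'[fun w => psi [:: false; false] w]%E \is a fin_num.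
  rewrite unlock ge0_fin_numE; last first.
    by apply: integral_ge0 => w _; rewrite lee_fin; case/andP: (psi01 w [:: false; false]).
  apply: (@le_lt_trans _ _ (\int[P']_w (cst 1%E w))%E).
    apply: ge0_le_integral_nonmeasurable => w; rewrite lee_fin;
      by case/andP: (psi01 w [:: false; false]).
  by rewrite integral_cst//= mul1e probability_setT ltry.
move: ('E_P'[_])%E => l /fineK <- El.
pose p m := sval (cid (integral_pair_density_asymp m hdens hchar)).
have pP m : (\int[mu2]_(z in @unit_square R) (pair_density m z)%:E)%E = (p m)%:E /\
    `|16 * p m - 2 * osc_int (fun=> 1) m + osc_int (@sin R) m| <= 6 * (3 / 4) ^+ m.
  by rewrite /p; case: cid.
(* Sample size [m.+2] makes the number of remaining points [m] and the factor [n.-1] equal to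
   [m.+1]. *)
have eP m : exists e : R, E m.+2 = e%:E /\
    `|e - m.+1%:R * p m| <= m.+2%:R^-1 + m.+2%:R * (2 * 2^-1 ^+ m.+2).
  rewrite /E unlock.
  exact: (expected_subtree_frac hmu1 hmu2 hchar (isT : (0 < m.+2)%N) (hZ m.+2) (pP m).1).
pose e m := sval (cid (eP m)).
have eE m : E m.+2 = (e m)%:E by rewrite /e; case: cid => ? [].
have eB m : `|e m - m.+1%:R * p m| <= m.+2%:R^-1 + m.+2%:R * (2 * 2^-1 ^+ m.+2).
  by rewrite /e; case: cid => ? [].
have el : e m @[m --> \oo] --> fine l.
  have : E m.+2 @[m --> \oo] --> (fine l)%:E.
    by rewrite (cvg_shiftS (fun m => E m.+1)) cvg_shiftS.
  by under eq_fun do rewrite eE; move/fine_cvg.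
(* Up to a vanishing error [r], [(m+1)] times the sine integral is [4 - 16 * e m]; the 4 is twice
   the value given by [osc_int_cst1]. *)
apply: (@osc_int_sin_not_cvg R); apply/cvg_ex; exists (4 - 16 * fine l + 0).
pose r m := m.+1%:R * osc_int (@sin R) m - (4 - 16 * e m).
rewrite (_ : (fun n => _) = (fun m => 4 - 16 * e m + r m)); last first.
  by apply/funext => m; rewrite /r addrC subrK.
apply: cvgD.
  by apply: cvgB; [exact: cvg_cst|apply: cvgM; [exact: cvg_cst|exact: el]].
(* Here [198 = (6 + 16) * 9]: 6 from the error on [p m], 16 from the exceptional events, 9 from
   [linear_times_geometric]. *)
pose u (m : nat) : R := 16 * harmonic m + 198 * (7 / 8) ^+ m.
have ru m : `|r m| <= u m.
  have [_] := pP m; set S := osc_int (@sin R) m => hS.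
  have -> : r m = m.+1%:R * (16 * p m - 2 * osc_int (fun=> 1) m + S) +
      16 * (e m - m.+1%:R * p m).
    have := osc_int_cst1 R m; rewrite /r -/S; move: (osc_int _ m) => o ho.
    by rewrite !mulrDr mulrN [_ * (2 * o)]mulrCA ho; ring.
  apply: (le_trans (ler_normD _ _)).
  rewrite !normrM normr_nat (ger0_norm (_ : 0 <= 16))//.
  have h1 : m.+1%:R * `|16 * p m - 2 * osc_int (fun=> 1) m + S| <=
      6 * (m.+1%:R * (3 / 4) ^+ m) by rewrite mulrCA ler_wpM2l.
  have h2 : m.+2%:R^-1 <= harmonic m :> R by rewrite /harmonic lef_pV2 ?posrE// ler_nat.
  have h3 : m.+2%:R * (2 * 2^-1 ^+ m.+2) <= m.+1%:R * (3 / 4) ^+ m :> R.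
    have q1 : 2^-1 ^+ m <= (3 / 4) ^+ m :> R by rewrite lerXn2r ?nnegrE//; lra.
    have q0 : 0 <= 2^-1 ^+ m :> R by rewrite exprn_ge0// invr_ge0.
    have m0 : 0 <= m%:R :> R by [].
    apply: (@le_trans _ _ (m.+1%:R * 2^-1 ^+ m)); last by rewrite ler_pM2l.
    by rewrite -[m.+2%:R]natr1 -[m.+1%:R]natr1 !exprS; nra.
  have comb (a x h h' v f q : R) : a <= 6 * x -> h' <= h -> v <= x ->
    x <= 9 * q -> f <= h' + v -> a + 16 * f <= 16 * h + 198 * q by lra.
  exact: comb h1 h2 h3 (linear_times_geometric R m) (eB m).
have u0 : u m @[m --> \oo] --> 0.
  rewrite -[X in _ --> X](_ : 16 * 0 + 198 * 0 = 0); last by rewrite !mulr0 addr0.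
  apply: cvgD; (apply: cvgM; first exact: cvg_cst).
    exact: cvg_harmonic.
  by apply: cvg_expr; rewrite ger0_norm; lra.
apply: (@squeeze_cvgr _ _ _ _ (fun m => - u m) u) => //.
  by near=> m; rewrite -ler_norml.
by rewrite -oppr0; exact: cvgN.
Unshelve. all: by end_near. Qed.
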